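(* As $n\to\infty$: $\chi_{CF}(\mathsf{FC}_4(n))=\Theta(\sqrt{n})$, $\chi_{CF}(\mathsf{FC}_6(n))=\Theta(\sqrt{n})$, $\chi_{CF}(\mathsf{FC}_8(n))=\Theta(n^{2/3})$, $\chi_{CF}(\mathsf{FC}_{10}(n))=\Theta(\sqrt{n})$, $\chi_{CF}(\mathsf{FC}_{12}(n))=\Theta(n^{3/4})$, $\chi_{CF}(\mathsf{FC}_{14}(n))=\Theta(n^{2/3})$, $\chi_{CF}(\mathsf{FC}_{18}(n))=\Theta(n^{3/4})$, and $\chi_{CF}(\mathsf{FC}_{20}(n))=\Theta(n^{5/6})$.
   Context: A hypergraph is a pair $(V,\mathcal{E})$ with $\mathcal{E}\subseteq 2^V$. A conflict-free coloring (CF-coloring) of a hypergraph is a map $\varphi$ on $V$ such that every nonempty hyperedge $e$ contains a vertex $x$ with $\varphi(y)\ne\varphi(x)$ for all $y\in e\setminus\{x\}$; $\chi_{CF}(H)$ is the least number of colors in a CF-coloring of $H$. For $n\ge d+1$, $\mathsf{C}_d(n)$ is the convex hull of $\gamma_d(1),\dots,\gamma_d(n)$ where $\gamma_d(t)=(t,t^2,\dots,t^d)$, and we identify $\gamma_d(i)$ with $i\in[n]$. $\mathsf{FC}_d(n)$ is the $d$-uniform hypergraph on $[n]$ whose hyperedges are the vertex sets of facets of $\mathsf{C}_d(n)$. Equivalently (Gale's evenness criterion), a $d$-subset $S\subseteq[n]$ is a hyperedge iff for all $i,j\in[n]\setminus S$ the set $\{k\in S: i<k<j\}$ has even size. *)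

(* Defs.v *)
From HB Require Import structures.
From mathcomp Require Import all_boot all_order all_algebra.
From mathcomp Require Import all_classical all_reals all_analysis.

Set Implicit Arguments.
Unset Strict Implicit.
Unset Printing Implicit Defensive.

Import Order.TTheory GRing.Theory Num.Theory.
Import numFieldNormedType.Exports.

Local Open Scope classical_set_scope.
Local Open Scope ring_scope.

(* A hypergraph on the finite vertex type V is given by its edge set
   H : {set {set V}}. *)
Section ConflictFree.
Variable V : finType.
Implicit Type H : {set {set V}}.

Definition cf_coloring (C : eqType) H (phi : V -> C) : bool :=
  [forall e in H, (e != finset.set0) ==>
     [exists x in e, [forall y in (e :\ x)%SET, phi y != phi x]]].

Definition cf_colorable H (k : nat) : bool :=
  [exists phi : {ffun V -> 'I_k}, cf_coloring H phi].

Lemma cf_colorable_ex H : exists k, cf_colorable H k.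
Proof.
exists #|V|; apply/existsP; exists (finfun enum_rank).
apply/'forall_implyP => e _; apply/implyP => /set0Pn[x xe].
apply/'exists_andP; exists x; split=> //; apply/'forall_implyP => y.
by rewrite !inE !ffunE (inj_eq enum_rank_inj) => /andP[].
Qed.

Definition chi_CF H : nat := ex_minn (cf_colorable_ex H).

End ConflictFree.

Section Polytopes.
Variables (R : realType) (d : nat).
Implicit Types (P F A : set 'rV[R]_d) (U W : {vspace 'rV[R]_d}).

Definition dotmul (a x : 'rV[R]_d) : R := \sum_(j < d) a 0 j * x 0 j.

Definition convex_hull A : set 'rV[R]_d :=
  smallest (@convex_set R 'rV[R]_d) A.

(* Intersections with supporting hyperplanes; a = 0 also gives the two
   improper faces, P itself and the empty set. *)
Definition is_face P F : Prop := exists (a : 'rV[R]_d) (b : R),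
  (forall x, P x -> dotmul a x <= b) /\ F = P `&` [set x | dotmul a x = b].

(* U is the least linear subspace containing all differences of points of A,
   so that the affine hull of a nonempty A is x + U for any x in A. *)
Definition is_direction A U : Prop :=
  (forall x y, A x -> A y -> x - y \in U) /\
  (forall W, (forall x y, A x -> A y -> x - y \in W) -> (U <= W)%VS).

Definition has_affine_dim A (k : nat) : Prop :=
  A !=set0 /\ exists2 U, is_direction A U & \dim U = k.

Definition is_facet P F : Prop := is_face P F /\
  exists2 k : nat, has_affine_dim P k.+1 & has_affine_dim F k.

Definition vertices P : set 'rV[R]_d := [set v | is_face P [set v]].

Definition moment_curve (t : R) : 'rV[R]_d := \row_(j < d) t ^+ j.+1.

(* The index i : 'I_n stands for the element i + 1 of [n] = {1, ..., n}. *)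
Definition cyclic_point (n : nat) (i : 'I_n) : 'rV[R]_d :=
  moment_curve (i.+1)%:R.

Definition cyclic_polytope (n : nat) : set 'rV[R]_d :=
  convex_hull (range (@cyclic_point n)).

Definition FC (n : nat) : {set {set 'I_n}} :=
  [set S : {set 'I_n} | `[< exists2 F, is_facet (cyclic_polytope n) F &
     vertices F = @cyclic_point n @` [set i | i \in S] >] ]%SET.

End Polytopes.

(* Main.v *)
(** Gale's criterion makes the facets of [C_2m(n)] avoiding the first point the unions of m
disjoint pairs of consecutive indices.  A colouring turns such pairs into edges of a graph
on the colours, and a facet without a uniquely coloured vertex is a set of m edges in
which every vertex met has degree at least 2 (a "leafless" set).  So the question is how
many edges a k-vertex graph can have without a leafless set of m edges.

Upper bound on edges: a dense bipartite graph has a breadth-first search in which two consecutive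
layers contain a subgraph of large minimum degree, and long paths there, closed up through
the search tree, give a cycle of length 2r, a 6- or 8-cycle with a chord, or a theta
graph with 9 edges.  Parallel pairs give the exponent 1/2.

Lower bound on edges: points and lines of F_q^r, with only the directions [(1, t, ..., t^(r-1))]
allowed (Wenger's graphs), form a graph with [2 q^r] vertices and [q^(r+1)] edges and no leafless
set of the relevant size.  Its edges split into at most [2 q^r] trails, which are
written one after another with uniquely coloured separators. *)

Require Import Defs.
From HB Require Import structures.
From mathcomp Require Import all_boot all_order.
From mathcomp Require Import boolp.
From mathcomp Require Import zify.

Set Implicit Arguments.
Unset Strict Implicit.
Unset Printing Implicit Defensive.

(** * Dense bipartite graphs contain leafless edge sets *)

(** The exponent comes from the search. If no two consecutive layers are dense, each layer is about
    [K] times larger than the one before, which is impossible once [K ^ r] exceeds the number of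
    vertices. So of the order of k^(1+1/r) distinct pairs force a pattern within [r] layers, and a
    Wenger graph with 2 q^r vertices and q^(r+1) edges matches this. The orders of magnitude agree
    for those m whose forced set and whose pattern-free graph have the same [r]. That a graph has no
    leafless set of m edges is mostly a count, since such a set meets at most m/2 points and m/2
    lines. Sizes 2, 3, 5 fit in no simple bipartite graph; sizes 4, 7 need a 4-cycle; sizes 6, 9
    need a 4- or 6-cycle. Size 10 survives the count, as the 10-cycle, and needs algebra. Gale's
    criterion allows odd blocks at the two ends. Hence the first point receives a separator: a facet
    through it has a uniquely coloured vertex at once, and any other facet splits into pairs because
    its size is even. *)

Section Leafless.
Variables (V : finType) (e : rel V).

Definition leafless (S : {set {set V}}) : Prop :=
  (forall f, f \in S -> exists u v, e u v /\ f = [set u; v]) /\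
  (forall f v, f \in S -> v \in f -> exists f', [/\ f' \in S, f' != f & v \in f']).

Lemma leafless_add (S : {set {set V}}) (u v : V) :
  leafless S -> e u v -> u \in cover S -> v \in cover S -> [set u; v] \notin S ->
  leafless ([set u; v] |: S) /\ #|[set u; v] |: S| = #|S|.+1.
Proof.
move=> [S1 S2] euv /bigcupP[fu fuS ufu] /bigcupP[fv fvS vfv] nS; split; last by rewrite cardsU1 nS.
split=> [f|f w].
  by rewrite in_setU1 => /orP[/eqP->|/S1//]; exists u, v.
rewrite in_setU1 => /orP[/eqP->|fS].
  rewrite !inE => /orP[]/eqP->; [exists fu|exists fv]; rewrite in_setU1.
    by rewrite fuS orbT; split=> //; apply: contraNneq nS => <-.
  by rewrite fvS orbT; split=> //; apply: contraNneq nS => <-.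
by move=> /(S2 _ _ fS)[f' [f'S ne wf']]; exists f'; rewrite in_setU1 f'S orbT.
Qed.

Definition cycle_edges (s : seq V) : {set {set V}} :=
  [set [set v; next s v] | v in s].

Lemma next_distinct (s : seq V) (v : V) : uniq s -> 2 < size s -> v \in s ->
  [/\ next s v != v & next s (next s v) != v].
Proof.
move=> us ss vs; case: (rot_to vs) => i s' Es.
have us' : uniq (v :: s') by rewrite -Es rot_uniq.
have ss' : 2 < size (v :: s') by rewrite -Es size_rot.
have E w : next s w = next (v :: s') w by rewrite -Es next_rot.
rewrite !E; case: s' us' ss' {Es E} => [|y [|z t]] //= /and3P[].
rewrite !inE !negb_or eqxx => /and3P[vy vz _] _ _ _.
by rewrite (eq_sym y) vy (negbTE vy) eqxx (eq_sym z).
Qed.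

Lemma cycle_edges_inj (s : seq V) : uniq s -> 2 < size s ->
  {in s &, injective (fun v => [set v; next s v])}.
Proof.
move=> us ss v u vs uS /setP E.
have := E v; rewrite !inE eqxx /= => /esym/orP[/eqP//|/eqP vu].
have := E u; rewrite !inE eqxx /= => /orP[/eqP//|/eqP uv].
by have [_] := next_distinct us ss vs; rewrite -uv -vu eqxx.
Qed.

Lemma mem_cover_cycle_edges (s : seq V) (v : V) : v \in s -> v \in cover (cycle_edges s).
Proof.
by move=> vs; apply/bigcupP; exists [set v; next s v]; rewrite ?inE ?eqxx //; apply: imset_f.
Qed.

Lemma cycle_leafless (s : seq V) : uniq s -> cycle e s -> 2 < size s ->
  leafless (cycle_edges s) /\ #|cycle_edges s| = size s.
Proof.
move=> us cs ss; have inj := cycle_edges_inj us ss.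
split; last by rewrite card_in_imset // (card_uniqP us).
split=> [f /imsetP[v vs ->]|f w /imsetP[v vs ->]].
  by exists v, (next s v); split=> //; apply: next_cycle.
have [nv _] := next_distinct us ss vs.
rewrite !inE => /orP[]/eqP->.
  exists [set prev s v; next s (prev s v)]; rewrite !inE next_prev // eqxx orbT.
  split=> //; first by rewrite -[X in [set _; X]](next_prev us v); apply: imset_f; rewrite mem_prev.
  apply/eqP => E; have := inj (prev s v) v; rewrite mem_prev next_prev // => /(_ vs vs E) pv.
  by move: nv; rewrite -{1}pv next_prev // eqxx.
exists [set next s v; next s (next s v)]; rewrite !inE eqxx.
split=> //; first by apply: imset_f; rewrite mem_next.
by apply/eqP => /inj; rewrite mem_next => /(_ vs vs) E; rewrite E eqxx in nv.
Qed.

(** The last two inequalities exclude the cycle edges, so the chord really adds one edge. *)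
Lemma chord_leafless (s : seq V) (u v : V) : uniq s -> cycle e s -> 2 < size s ->
  u \in s -> v \in s -> e u v -> u != v -> next s u != v -> next s v != u ->
  exists2 S, leafless S & #|S| = (size s).+1.
Proof.
move=> us cs ss u_s v_s euv uv nuv nvu; have [ls cards] := cycle_leafless us cs ss.
have := leafless_add ls euv (mem_cover_cycle_edges u_s) (mem_cover_cycle_edges v_s).
case=> [|ls' cards']; last by exists ([set u; v] |: cycle_edges s); rewrite ?cards' ?cards.
apply/imsetP => -[w ws /setP E].
have := E u; have := E v; rewrite !inE !eqxx !orbT /= => /esym/orP[]/eqP Ev /esym/orP[]/eqP Eu.
- by rewrite Ev Eu eqxx in uv.
- by rewrite Ev -Eu eqxx in nvu.
- by rewrite Eu -Ev eqxx in nuv.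
- by rewrite Ev Eu eqxx in uv.
Qed.

End Leafless.

Section Dense.
Variables (V : finType) (e : rel V).
Hypothesis esym : symmetric e.

Definition nbr (W : {set V}) (v : V) : {set V} := [set u in W | e v u].

Lemma sum_nbr_exchange (A B : {set V}) :
  \sum_(v in A) #|nbr B v| = \sum_(u in B) #|nbr A u|.
Proof.
have E (X Y : {set V}) : \sum_(v in X) #|nbr Y v| = \sum_(v in X) \sum_(u in Y) (e v u : nat).
  apply: eq_bigr => v _; rewrite -sum1_card big_mkcond [RHS]big_mkcond /=.
  by apply: eq_bigr => u _; rewrite inE; case: (u \in Y); case: (e v u).
rewrite !E exchange_big /=; apply: eq_bigr => u _; apply: eq_bigr => v _.
by rewrite esym.
Qed.

(** Delete repeatedly a vertex with at most [D] neighbours left: it removes its own degree and as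
    much from the others, at most [2 * D] in all, so the density hypothesis survives. Being strict,
    it never lets the set become empty. *)
Lemma dense_core (D : nat) (W : {set V}) : irreflexive e ->
  (2 * D) * #|W| < \sum_(v in W) #|nbr W v| ->
  exists W' : {set V}, [/\ W' \subset W, W' != set0 &
                      forall v, v \in W' -> D < #|nbr W' v|].
Proof.
move=> eirr; have [n] := ubnP #|W|; elim: n W => // n IH W Wn Wd.
have [/forall_inP core|/forall_inPn[v vW vd]] := boolP [forall v in W, D < #|nbr W v|].
  exists W; split=> //; apply: contraTneq Wd => ->.
  by rewrite big_set0.
have [||W' [W'W W'0 core]] := IH (W :\ v).
- by move: Wn; rewrite (cardsD1 v W) vW.
- move: Wd; rewrite (cardsD1 v W) vW (big_setD1 v vW) /=.
  have E u : u \in W :\ v -> #|nbr W u| = #|nbr (W :\ v) u| + #|nbr [set v] u|.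
    move=> _; rewrite -cardsUI.
    have -> : nbr (W :\ v) u :&: nbr [set v] u = set0.
      by apply/setP => w; rewrite !inE; case: (w == v) => //=; rewrite !andbF.
    rewrite cards0 addn0; apply: eq_card => w; rewrite !inE.
    by have [->|] := eqVneq w v; rewrite ?vW //= orbF.
  rewrite (eq_bigr _ E) big_split /= sum_nbr_exchange big_set1.
  have : #|nbr (W :\ v) v| <= #|nbr W v|.
    by apply: subset_leq_card; apply/subsetP => w; rewrite !inE => /andP[/andP[_ ->] ->].
  by move: vd; rewrite -leqNgt; lia.
by exists W'; split=> //; apply: subset_trans W'W (subD1set _ _).
Qed.

(** Greedy walk: each visited vertex joins the forbidden set [X], at the price of one unit of the
    budget [D]. The start [w] itself may lie in [X]. *)
Lemma long_path (D t : nat) (W X : {set V}) (w : V) :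
  (forall v, v \in W -> D < #|nbr W v|) -> w \in W -> #|X| + t <= D ->
  exists p, [/\ path e w p, size p = t, uniq (w :: p), {subset p <= W} &
                forall v, v \in p -> v \notin X].
Proof.
move=> core; elim: t w X => [|t IH] w X wW Xt; first by exists [::].
have [v] : exists v, v \in nbr W w :\: (w |: X).
  apply/set0Pn; rewrite -card_gt0 cardsD subn_gt0.
  apply: leq_ltn_trans (subset_leq_card (subsetIr _ _)) _.
  rewrite cardsU1; apply: leq_ltn_trans (core _ wW).
  by case: (w \notin X); lia.
rewrite !inE negb_or => /andP[/andP[vw vX] /andP[vW ewv]].
have [|p [pp sp up pW pX]] := IH v (w |: X) vW.
  by rewrite cardsU1; case: (w \notin X); lia.
exists (v :: p); split=> [||||u]; rewrite ?inE /=.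
- by rewrite ewv.
- by rewrite sp.
- rewrite inE negb_or eq_sym vw -/(uniq (v :: p)) up andbT /=.
  by apply/negP => /pX; rewrite !inE eqxx.
- by move=> u; rewrite inE => /orP[/eqP->//|/pW].
- by move=> /orP[/eqP->//|/pX]; rewrite !inE negb_or => /andP[].
Qed.

End Dense.

(** * Breadth-first layers and their growth *)

Section Layers.
Variables (V : finType) (e : rel V) (col : V -> bool) (x : V).
Hypothesis esym : symmetric e.
Hypothesis bip : forall u v, e u v -> col u != col v.

Lemma bip_irr : irreflexive e.
Proof. by move=> v; apply/negP => /bip; rewrite eqxx. Qed.

(** These are the balls around [x]; [layer] gives the spheres. *)
Fixpoint reach (i : nat) : {set V} :=
  if i is j.+1 then reach j :|: [set v | [exists u in reach j, e u v]] else [set x].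

Definition layer (i : nat) : {set V} :=
  if i is j.+1 then reach j.+1 :\: reach j else [set x].

Lemma ball_mono i j : i <= j -> reach i \subset reach j.
Proof.
move=> /subnKC <-; elim: (j - i) => [|k IH]; first by rewrite addn0.
by rewrite addnS; apply: subset_trans IH (subsetUl _ _).
Qed.

Lemma ball_nbr i u v : u \in reach i -> e u v -> v \in reach i.+1.
Proof. by move=> ui uv; rewrite !inE; apply/orP; right; apply/exists_inP; exists u. Qed.

Lemma lay_ball i : layer i \subset reach i.
Proof. by case: i => [|i] //; apply: subsetDl. Qed.

Lemma ball_lay i v : v \in reach i -> exists2 j, j <= i & v \in layer j.
Proof.
elim: i => [|i IH]; first by exists 0.
have [/IH[j ji vj] _|nv vi] := boolP (v \in reach i).
  by exists j => //; apply: leqW.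
by exists i.+1 => //; rewrite in_setD nv.
Qed.

Lemma lay_notball i j v : v \in layer j -> i < j -> v \notin reach i.
Proof.
case: j => [//|j]; rewrite in_setD => /andP[nv _] ij.
by apply: contraNN nv; apply/subsetP/ball_mono.
Qed.

Lemma lay_inj i j v : v \in layer i -> v \in layer j -> i = j.
Proof.
move=> vi vj; have [ij|ji|//] := ltngtP i j.
  by have := lay_notball vj ij; rewrite (subsetP (lay_ball i) _ vi).
by have := lay_notball vi ji; rewrite (subsetP (lay_ball j) _ vj).
Qed.

Lemma lay_parent i v : v \in layer i.+1 -> exists2 u, u \in layer i & e u v.
Proof.
move=> vi; have := subsetP (lay_ball _) _ vi.
rewrite in_setU (negbTE (lay_notball vi (ltnSn i))) /= inE => /exists_inP[u ui uv].
exists u => //; have [j ji uj] := ball_lay ui.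
have [<-//|ne] := eqVneq j i.
have lt : j.+1 < i.+1 by rewrite ltnS ltn_neqAle ne.
by have := lay_notball vi lt; rewrite (ball_nbr _ uv) // (subsetP (lay_ball j)).
Qed.

Lemma lay_col i v : v \in layer i -> col v = col x (+) odd i.
Proof.
elim: i v => [|i IH] v; first by rewrite inE addbF => /eqP->.
move=> /lay_parent[u /IH E /bip]; rewrite /= E.
by case: (col v); case: (col x); case: (odd i).
Qed.

(** Distance changes by at most one along an edge, and no edge stays inside a layer because, by
    [lay_col], the parity of the index determines the colour. *)
Lemma lay_nbr i v u : v \in layer i -> e v u -> u \in layer i.+1 \/ (0 < i /\ u \in layer i.-1).
Proof.
move=> vi vu; have uB := ball_nbr (subsetP (lay_ball i) _ vi) vu.
have [j ji uj] := ball_lay uB.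
have lt : i <= j.+1.
  rewrite leqNgt; apply/negP => /(lay_notball vi).
  by rewrite (ball_nbr (subsetP (lay_ball j) _ uj)) // esym.
have : j != i.
  by apply: contraTneq (bip vu) => E; rewrite (lay_col vi) (lay_col uj) E eqxx.
have : j = i.+1 \/ j = i \/ j.+1 = i by lia.
case=> [E|[->|E]]; rewrite ?eqxx //; first by left; rewrite -E.
by move=> _; right; rewrite -E.
Qed.

(** This fixes one search tree. A single function serves all layers, since a vertex lies in at most
    one of them. *)
Lemma exists_parent : exists par : V -> V,
  forall i v, v \in layer i.+1 -> par v \in layer i /\ e (par v) v.
Proof.
have H v : exists u, forall i, v \in layer i.+1 -> u \in layer i /\ e u v.
  have [[i vi]|none] := pselect (exists i, v \in layer i.+1).
    have [u ui uv] := lay_parent vi; exists u => j vj.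
    by have [<-] := lay_inj vi vj.
  by exists v => i vi; case: none; exists i.
by have [par parP] := choice H; exists par => i v; apply: parP.
Qed.

Section LayerGrowth.
Variables (D K r : nat).
Hypothesis D0 : 0 < D.
Hypothesis K0 : 0 < K.
Hypothesis mindeg : forall u v, e u v -> D * (K + 3) <= #|nbr e [set: V] u|.
Hypothesis xdeg : D * (K + 3) <= #|nbr e [set: V] x|.
Hypothesis sparse : forall i, 0 < i < r -> forall W : {set V},
  W \subset layer i :|: layer i.+1 -> W != set0 -> exists2 v, v \in W & #|nbr e W v| <= D.

(** A larger count would make the two layers together dense, and [dense_core] would contradict
    [sparse]. The case [i = 0], which [sparse] does not cover, is the star at [x]. *)
Lemma edges_between i : i < r ->
  \sum_(v in layer i) #|nbr e (layer i.+1) v| <= D * (#|layer i| + #|layer i.+1|).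
Proof.
case: i => [_|i ir].
  rewrite big_set1 cards1.
  have : #|nbr e (layer 1) x| <= #|layer 1|.
    by apply: subset_leq_card; apply/subsetP => v; rewrite inE => /andP[].
  nia.
set A := layer i.+1; set B := layer i.+2; set W := A :|: B.
have dAB : [disjoint A & B].
  rewrite -setI_eq0; apply/eqP/setP => v; rewrite in_setI in_set0.
  by apply/negP => /andP[vA vB]; have := lay_inj vA vB; lia.
have cW : #|W| = #|A| + #|B| by rewrite cardsU disjoint_setI0 // cards0 subn0.
have : \sum_(v in W) #|nbr e W v| <= (2 * D) * #|W|.
  rewrite leqNgt; apply/negP => /(dense_core esym bip_irr) [W' [sW W0 core]].
  have [v vW] := @sparse i.+1 ir W' sW W0.
  by rewrite leqNgt core.
rewrite /W (eq_bigl [predU A & B]); last by move=> v; rewrite !inE.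
rewrite bigU //= -/W cW.
have leA : \sum_(v in A) #|nbr e B v| <= \sum_(v in A) #|nbr e W v|.
  apply: leq_sum => v _; apply: subset_leq_card; apply/subsetP => w.
  by rewrite !inE => /andP[-> ->]; rewrite orbT.
have leB : \sum_(v in B) #|nbr e A v| <= \sum_(v in B) #|nbr e W v|.
  apply: leq_sum => v _; apply: subset_leq_card; apply/subsetP => w.
  by rewrite !inE => /andP[-> ->].
have := sum_nbr_exchange esym A B; lia.
Qed.

(** All edges at the middle layer go to its two neighbours. Applying [edges_between] twice costs
    [2 * D] per middle vertex, which turns the degree [D * (K + 3)] into the factor [K + 1]. *)
Lemma layer_recurrence i : i.+1 < r -> (K + 1) * #|layer i.+1| <= #|layer i| + #|layer i.+2|.
Proof.
move=> ir; rewrite -(leq_pmul2l D0).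
have e1 := edges_between (ltnW ir); have e2 := edges_between ir.
have : \sum_(v in layer i.+1) D * (K + 3) <=
    \sum_(v in layer i.+1) (#|nbr e (layer i) v| + #|nbr e (layer i.+2) v|).
  apply: leq_sum => v vi; have [u ui uv] := lay_parent vi.
  have vu : e v u by rewrite esym.
  apply: leq_trans (mindeg vu) _; apply: leq_trans (leq_card_setU _ _).
  apply: subset_leq_card; apply/subsetP => w; rewrite inE in_setU !in_set => /andP[_ vw].
  have [wi|[_ wi]] := lay_nbr vi vw; last by rewrite /= in wi; rewrite wi vw.
  by move: wi; rewrite /= !inE vw => ->; rewrite orbT.
rewrite sum_nat_const big_split /= (sum_nbr_exchange esym (layer i.+1) (layer i)).
move: e1 e2; move: (\sum_(v in layer i) _) (\sum_(v in layer i.+1) _) #|layer i| #|layer i.+1| #|layer i.+2|.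
clear; nia.
Qed.

(** The extra 1 in the factor [K + 1] of the recurrence absorbs the previous layer, which by
    induction is no larger than the middle one; growth by [K] remains. *)
Lemma layer_growth i : i <= r ->
  K ^ i <= #|layer i| /\ (i < r -> K * #|layer i| <= #|layer i.+1|).
Proof.
have K_ge : 0 < r -> K * #|layer 0| <= #|layer 1|.
  move=> _; rewrite /layer -/layer cards1 muln1.
  have : #|nbr e [set: V] x| <= #|reach 1 :\: reach 0|.
    apply: subset_leq_card; apply/subsetP => v; rewrite in_set => /andP[_ xv].
    rewrite in_setD (ball_nbr _ xv) ?inE //= andbT.
    by apply/eqP => E; rewrite E bip_irr in xv.
  by move: xdeg; nia.
elim: i => [|i IH] ir; first by split=> //; rewrite cards1.
have [Ki Kg] := IH (ltnW ir); have {}Kg := Kg ir.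
split=> [|ir']; first by rewrite expnS; nia.
have := layer_recurrence ir'; nia.
Qed.

End LayerGrowth.

(** Otherwise [layer r] would have at least [K ^ r] vertices. The degree bound is asked only of [x]
    and of vertices with an edge, since the relation will be the restriction to a core, which
    isolates everything outside. *)
Lemma layered_core (D K r : nat) : 0 < D -> 0 < K -> #|V| < K ^ r ->
  (forall u v, e u v -> D * (K + 3) <= #|nbr e [set: V] u|) ->
  D * (K + 3) <= #|nbr e [set: V] x| ->
  exists i (W : {set V}), [/\ 0 < i < r, W \subset layer i :|: layer i.+1, W != set0 &
                  forall v, v \in W -> D < #|nbr e W v|].
Proof.
move=> D0 K0 VK mindeg xdeg.
apply: contrapT => none.
have [|] := @layer_growth D K r D0 K0 mindeg xdeg _ r (leqnn r).
  move=> i ir W sW W0; apply: contrapT => noW; apply: none; exists i, W; split=> // v vW.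
  by rewrite ltnNge; apply/negP => vD; apply: noW; exists v.
by move=> H _; have := leq_trans VK H; rewrite ltnNge max_card.
Qed.

End Layers.

(** Each new interior vertex gets two of the new edges, and the ends were covered before. Glued to a
    6-cycle, such an ear gives the theta graph with 9 edges. *)
Lemma leafless_ear (V : finType) (e : rel V) (S : {set {set V}}) (u v y z : V) :
  leafless e S -> u \in cover S -> v \in cover S -> y \notin cover S -> z \notin cover S ->
  y != z -> e u y -> e y z -> e z v ->
  exists2 S', leafless e S' & #|S'| = #|S| + 3.
Proof.
move=> [S1 S2] uS vS yS zS yz euy eyz ezv.
have neq (a b : V) : a \in cover S -> b \notin cover S -> a != b.
  by move=> aS; apply: contraNneq => <-.
have nS (f : {set V}) (b : V) : b \in f -> b \notin cover S -> f \notin S.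
  by move=> bf; apply: contraNN => fS; apply/bigcupP; exists f.
have [uy uz vy vz] := And4 (neq _ _ uS yS) (neq _ _ uS zS) (neq _ _ vS yS) (neq _ _ vS zS).
pose f1 := [set u; y]; pose f2 := [set y; z]; pose f3 := [set z; v].
have [n12 n13 n23] : [/\ f1 != f2, f1 != f3 & f2 != f3].
  split; apply/eqP => /setP E.
  - by have := E u; rewrite !inE eqxx (negbTE uy) (negbTE uz).
  - by have := E y; rewrite !inE eqxx orbT (negbTE yz) eq_sym (negbTE vy).
  - by have := E y; rewrite !inE eqxx (negbTE yz) eq_sym (negbTE vy).
have f1S : f1 \notin S by apply: nS yS; rewrite !inE eqxx orbT.
have f2S : f2 \notin S by apply: nS yS; rewrite !inE eqxx.
have f3S : f3 \notin S by apply: nS zS; rewrite !inE eqxx.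
exists (f1 |: (f2 |: (f3 |: S))); last first.
  clear -n12 n13 n23 f1S f2S f3S; clearbody f1 f2 f3.
  by rewrite cardsU1 in_setU1 in_setU1 (negbTE n12) (negbTE n13) (negbTE f1S)
    cardsU1 in_setU1 (negbTE n23) (negbTE f2S) cardsU1 f3S /= !add1n addn3.
have [/bigcupP[fu fuS ufu] /bigcupP[fv fvS vfv]] := (uS, vS).
split=> [f|f w].
  rewrite !in_setU1 => /or4P[/eqP->|/eqP->|/eqP->|/S1//];
    [by exists u, y|by exists y, z|by exists z, v].
rewrite !in_setU1 => /or4P[/eqP->|/eqP->|/eqP->|fS]; rewrite ?inE.
- case/orP => /eqP->; [exists fu|exists f2]; split.
  + by rewrite !in_setU1 fuS !orbT.
  + by apply: contraNneq f1S => <-.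
  + exact: ufu.
  + by rewrite !in_setU1 eqxx !orbT.
  + by rewrite eq_sym.
  + exact: set21.
- case/orP => /eqP->; [exists f1|exists f3]; split.
  + by rewrite in_setU1 eqxx.
  + exact: n12.
  + exact: set22.
  + by rewrite !in_setU1 eqxx !orbT.
  + by rewrite eq_sym.
  + exact: set21.
- case/orP => /eqP->; [exists f2|exists fv]; split.
  + by rewrite !in_setU1 eqxx !orbT.
  + exact: n23.
  + exact: set22.
  + by rewrite !in_setU1 fvS !orbT.
  + by apply: contraNneq f3S => <-.
  + exact: vfv.
by move=> /(S2 _ _ fS)[f' [f'S ne wf']]; exists f'; rewrite !in_setU1 f'S !orbT.
Qed.

(** * Cycles closed up through the search tree *)

Section LayeredCycles.
Variables (V : finType) (e : rel V) (col : V -> bool) (x : V) (par : V -> V).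
Hypothesis esym : symmetric e.
Hypothesis bip : forall u v, e u v -> col u != col v.
Local Notation layer := (layer e x).
Hypothesis parP : forall i v, v \in layer i.+1 -> par v \in layer i /\ e (par v) v.
Variables (i D : nat) (W : {set V}).
Hypothesis sW : W \subset layer i :|: layer i.+1.
Hypothesis W0 : W != set0.
Hypothesis core : forall v, v \in W -> D < #|nbr e W v|.

Lemma neq_lay k l u v : u \in layer k -> v \in layer l -> k != l -> u != v.
Proof. by move=> uk vl; apply: contra_neq => E; apply: (lay_inj uk); rewrite E. Qed.

Lemma layS_disj k u : u \in layer k.+1 -> u \in layer k -> False.
Proof. by move=> u1 u2; have := neq_lay u1 u2; rewrite eqxx neq_ltn ltnSn orbT => /(_ isT). Qed.

Lemma anc_lay k j v : j <= k -> v \in layer k -> iter j par v \in layer (k - j).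
Proof.
move=> jk vk; elim: j jk => [|j IH] jk; first by rewrite subn0.
have {IH} := IH (ltnW jk); rewrite (_ : k - j = (k - j.+1).+1); last by lia.
by move=> /parP[].
Qed.

Lemma climb_path k j v : j <= k -> v \in layer k -> path e v (traject par (par v) j).
Proof.
elim: j k v => [//|j IH] [//|k] v jk vk /=.
by have [pk pe] := parP vk; rewrite esym pe (IH k).
Qed.

Lemma climb_lay k j v u : j <= k -> v \in layer k -> u \in traject par (par v) j ->
  exists l, [/\ l < j, u = iter l.+1 par v & u \in layer (k - l.+1)].
Proof.
move=> jk vk /trajectP[l lj ->]; exists l; rewrite -iterSr; split=> //.
by apply: anc_lay => //; apply: leq_trans jk.
Qed.

Lemma climb_uniq k j v : j <= k -> v \in layer k -> uniq (traject par (par v) j).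
Proof.
elim: j k v => [//|j IH] [//|k] v jk vk.
have [pk pe] := parP vk; rewrite trajectS cons_uniq (IH k) // andbT.
apply/negP => /(@climb_lay k j (par v) _ jk pk)[l [lj _ pl]].
by have := lay_inj pk pl; lia.
Qed.

Lemma core_edge u v : u \in layer i -> v \in W -> e u v -> v \in layer i.+1.
Proof.
move=> ui vW uv; have := subsetP sW _ vW; rewrite in_setU => /orP[vi|//].
by have := bip uv; rewrite (lay_col bip ui) (lay_col bip vi) eqxx.
Qed.

Lemma core_edge' u v : u \in layer i.+1 -> v \in W -> e u v -> v \in layer i.
Proof.
move=> ui vW uv; have := subsetP sW _ vW; rewrite in_setU => /orP[//|vi].
by have := bip uv; rewrite (lay_col bip ui) (lay_col bip vi) eqxx.
Qed.

Lemma core_top : exists2 a, a \in W & a \in layer i.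
Proof.
case/set0Pn: W0 => v vW; have := subsetP sW _ vW; rewrite in_setU => /orP[vi|vi].
  by exists v.
have /card_gt0P[a] : 0 < #|nbr e W v| by apply: leq_ltn_trans (core vW).
by rewrite inE => /andP[aW va]; exists a => //; apply: core_edge' va.
Qed.

Lemma path_col u p : path e u p -> col (last u p) = col u (+) odd (size p).
Proof.
elim: p u => [|v p IH] u /=; first by rewrite addbF.
by case/andP => /bip uv /IH ->; move: uv; case: (col u); case: (col v); case: (odd _).
Qed.

Lemma last_even_path u p : u \in layer i -> last u p \in W -> path e u p -> ~~ odd (size p) ->
  last u p \in layer i.
Proof.
move=> ui lW pp /negbTE ev; have := path_col pp; rewrite ev addbF.
have := subsetP sW _ lW; rewrite in_setU => /orP[//|li].
rewrite (lay_col bip ui) (lay_col bip li) /=.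
by case: (col x); case: (odd i).
Qed.

(** In a core of degree at least 2 this fails for [j = 0], and it holds for [j = i], where all
    ancestors are the root. So there is a level at which the ancestors split for the last time. *)
Definition share (j : nat) : Prop := forall b a a', b \in W -> b \in layer i.+1 ->
  a \in nbr e W b -> a' \in nbr e W b -> iter j par a = iter j par a'.

(** The path alternates between the two layers, and consecutive vertices of [layer i] are neighbours
    of the vertex between them. So agreement is passed on two steps at a time. *)
Lemma share_path j u p : share j -> u \in W -> u \in layer i -> path e u p -> {subset p <= W} ->
  forall v, v \in p -> v \in layer i -> iter j par v = iter j par u.
Proof.
move=> sh; have [n] := ubnP (size p); elim: n u p => // n IH u [//|b [|a p]] sp uW ui /=.
  rewrite andbT => ub pW v; rewrite inE => /eqP-> bi.
  by case: (layS_disj (core_edge ui (pW b (mem_head _ _)) ub) bi).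
case/and3P => ub ba pp pW v.
have bW : b \in W by apply: pW; rewrite inE eqxx.
have aW : a \in W by apply: pW; rewrite !inE eqxx orbT.
have bi := core_edge ui bW ub; have ai := core_edge' bi aW ba.
have E : iter j par a = iter j par u.
  by apply: (sh b); rewrite // inE ?aW ?uW //= esym.
rewrite !inE => /or3P[/eqP->|/eqP->|vp] vi //.
  by case: (layS_disj bi vi).
rewrite -E; apply: (IH a p) vp vi => //=; first exact: ltnW sp.
by move=> w wp; apply: pW; rewrite !inE wp !orbT.
Qed.

(* At the last level where the ancestors of the neighbours [a], [a'] of some [b] still differ,
   a path of prescribed length leaves [b] through a third neighbour; its end has an ancestor
   different from that of [a] or of [a'], and the tree paths close up a cycle. *)
Lemma core_even_cycle (r : nat) : 0 < i < r -> 2 * r + 2 <= D ->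
  exists s, [/\ uniq s, cycle e s & size s = 2 * r].
Proof.
move=> /andP[i0 ir] Dr.
have [j [ji nsh sh]] : exists j, [/\ j < i, ~ share j & share j.+1].
  have sh_i : share i.
    move=> b a a' bW bi; rewrite !inE => /andP[aW ba] /andP[a'W ba'].
    have := anc_lay (leqnn i) (core_edge' bi aW ba).
    have := anc_lay (leqnn i) (core_edge' bi a'W ba').
    by rewrite subnn !inE => /eqP-> /eqP->.
  have nsh0 : ~ share 0.
    have [a aW ai] := core_top.
    have /card_gt0P[b] : 0 < #|nbr e W a| by apply: leq_ltn_trans (core aW).
    rewrite inE => /andP[bW ab]; have bi := core_edge ai bW ab.
    have : 1 < #|nbr e W b| by apply: leq_ltn_trans (core bW); lia.
    by case/card_gt1P => c [d [cb db cd]] sh; case/eqP: cd; apply: (sh b).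
  suff H k : k <= i -> share k -> exists j, [/\ j < i, ~ share j & share j.+1] by apply: (H i).
  elim: k => [//|k IH] ki shk.
  have [shk'|nshk] := pselect (share k); last by exists k.
  exact: IH (ltnW ki) shk'.
have [b [a [a' [bW bi ab a'b ne]]]] : exists b a a', [/\ b \in W, b \in layer i.+1,
    a \in nbr e W b, a' \in nbr e W b & iter j par a != iter j par a'].
  apply: contrapT => H; apply: nsh => b a a' bW bi ab a'b; apply/eqP/negPn/negP => ne.
  by apply: H; exists b, a, a'.
have [w] : exists w, w \in nbr e W b :\: [set a; a'].
  apply/set0Pn; rewrite -card_gt0 cardsD subn_gt0.
  apply: leq_ltn_trans (subset_leq_card (subsetIr _ _)) _.
  by apply: leq_ltn_trans (core bW); rewrite cards2; case: (a != a'); lia.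
rewrite !inE negb_or => /andP[/andP[wa wa'] /andP[wW bw]].
(* The cycle will consist of [c], [b], [w], this path, [j + 1] ancestors of its end [z] and [j]
   ancestors of [c]: [3 + 2 * (r - j - 2) + (j + 1) + j = 2 * r]. *)
have [|p [pp sp up pW pX]] := @long_path _ e D (2 * (r - j - 2)) W (b |: [set a; a']) w core wW.
  have tD : 3 + 2 * (r - j - 2) <= D by clear -ji ir Dr; lia.
  apply: leq_trans tD; rewrite leq_add2r cardsU1 cards2.
  by case: (a != a'); case: (b \notin _).
have bp : b \notin p by apply/negP => /pX; rewrite !inE eqxx.
have wi := core_edge' bi wW bw.
set z := last w p; have zi : z \in layer i.
  apply: last_even_path => //; last by rewrite sp oddM.
  by rewrite /z; case: (p) pW => [|y q] //= pW; apply/pW/mem_last.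
have [c [cb cw cp cz]] : exists c, [/\ c \in nbr e W b, c != w, c \notin p &
    iter j par c != iter j par z].
  have [E|E] := eqVneq (iter j par a) (iter j par z).
    exists a'; rewrite (eq_sym _ w) -E (eq_sym (iter _ _ a')); split=> //.
    by apply/negP => /pX; rewrite !inE eqxx !orbT.
  exists a; rewrite (eq_sym _ w); split=> //.
  by apply/negP => /pX; rewrite !inE eqxx !orbT.
move: (cb); rewrite inE => /andP[cW bc].
have ci := core_edge' bi cW bc.
have pathq : path e c (b :: w :: p) by rewrite /= esym bc bw.
have qW : {subset b :: w :: p <= W}.
  by move=> u; rewrite !inE => /or3P[/eqP->|/eqP->|/pW].
have Ez : iter j.+1 par z = iter j.+1 par c.
  by apply: (share_path sh cW ci pathq qW) => //; rewrite inE mem_last orbT.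
have uq : uniq (c :: b :: w :: p).
  rewrite cons_uniq !inE !negb_or cp cw (neq_lay ci bi) ?neq_ltn ?ltnSn //=.
  by rewrite inE negb_or bp (neq_lay bi wi) ?neq_ltn ?ltnSn ?orbT.
have cqi u : u \in c :: b :: w :: p -> exists2 l, u \in layer l & i <= l.
  rewrite inE => /orP[/eqP->|/qW uW]; first by exists i.
  by have := subsetP sW _ uW; rewrite in_setU => /orP[]; [exists i|exists i.+1].
(* The first climb includes the common ancestor, the second stops just below it. They are disjoint:
   a common vertex would make the ancestors of [c] and [z] at level [j] agree. *)
exists ((c :: b :: w :: p) ++ traject par (par z) j.+1 ++ rev (traject par (par c) j)).
split.
- rewrite cat_uniq uq cat_uniq (climb_uniq ji zi) rev_uniq (climb_uniq (ltnW ji) ci) andbT !andTb.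
  apply/andP; split.
    apply/hasPn => u; rewrite mem_cat mem_rev => H; apply/negP => /cqi[l ul il].
    case/orP: H => [/(climb_lay ji zi)|/(climb_lay (ltnW ji) ci)] [k [_ _ uk]];
      by have := lay_inj ul uk; clear -il i0; lia.
  apply/hasPn => u; rewrite mem_rev => /(climb_lay (ltnW ji) ci)[k [kj Ek uk]].
  apply/negP => /(climb_lay ji zi)[l [lj El ul]].
  have Ekl : k = l by have := lay_inj uk ul; clear -ji kj lj; lia.
  case/eqP: cz; rewrite -(subnK kj) !iterD; congr iter.
  by rewrite -Ek El Ekl.
- change (path e c (rcons ((b :: w :: p) ++ traject par (par z) j.+1 ++
    rev (traject par (par c) j)) c)).
  rewrite rcons_cat rcons_cat -rev_cons cat_path pathq andTb.
  have -> : last c (b :: w :: p) = z by [].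
  rewrite cat_path (climb_path ji zi) andTb.
  have Elast v : last v (traject par (par v) j.+1) = iter j.+1 par v.
    by rewrite -[LHS]/(last v (v :: traject par (par v) j.+1)) -trajectS trajectSr last_rcons.
  rewrite -[X in path e X]/(last z (traject par (par z) j.+1)) Elast Ez -Elast.
  have -> : c :: traject par (par c) j = belast c (traject par (par c) j.+1).
    have := lastI c (traject par (par c) j.+1).
    rewrite -trajectS trajectSr => H.
    exact: (congr1 fst (rcons_inj H) : traject par c j.+1 = _).
  rewrite rev_path (eq_path (e' := e)); last by move=> u v; rewrite esym.
  exact: climb_path ci.
- by rewrite !size_cat size_rev !size_traject /= sp; clear -ji ir; lia.
Qed.

(** A path of [2 * l] edges from [layer i] ends in [layer i], and all its vertices there have one
    parent, through which it closes to a cycle of length [2 * l + 2]. As [1 < l], the edge from the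
    parent to the second such vertex [a1] is a chord. *)
Lemma core_common_parent (l : nat) : 0 < i -> share 1 -> 1 < l -> 2 * l <= D ->
  exists2 S, leafless e S & #|S| = 2 * l + 3.
Proof.
move=> i0 sh l1 lD; have [a aW ai] := core_top.
have [|p [pp sp up pW _]] := @long_path _ e D (2 * l) W set0 a core aW.
  by rewrite cards0.
have [pi pe] : par a \in layer i.-1 /\ e (par a) a by apply: parP; rewrite prednK.
have low v : v \in a :: p -> v != par a.
  move=> vp; have : v \in W by move: vp; rewrite inE => /orP[/eqP->|/pW].
  move=> /(subsetP sW); rewrite in_setU => /orP[] vi; apply: (neq_lay vi pi); clear -i0; lia.
have lastW : last a p \in W.
  by case: (p) pW => [|y q] //= pW; apply/pW/mem_last.
have lasti : last a p \in layer i by apply: last_even_path => //; rewrite sp oddM.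
have lastp : par (last a p) = par a.
  case: (p) sp lasti pp pW => [|y q]; first by move=> /= H *; clear -H l1; lia.
  move=> _ lasti pp pW; apply: (share_path sh aW ai pp pW) => //=; exact: mem_last.
have elast : e (last a p) (par a).
  rewrite -lastp esym; have [//|_ //] : _ /\ _ := @parP i.-1 (last a p) _.
  by rewrite prednK.
have us : uniq (par a :: a :: p).
  by rewrite cons_uniq up andbT; apply/negP => /low; rewrite eqxx.
have cs : cycle e (par a :: a :: p).
  by rewrite /= rcons_path pe pp.
case: p sp pp pW us cs low {up lastW lasti lastp elast} => [|b [|a1 [|b2 [|a2 p]]]] sp pp pW us cs low;
  try by move: sp => /= H; clear -H l1; lia.
have bi : b \in layer i.+1.
  by apply: (core_edge ai); [apply: pW; rewrite mem_head | case/andP: pp].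
have a1i : a1 \in layer i.
  by apply: (core_edge' bi); [apply: pW; rewrite !inE eqxx orbT | case/and3P: pp].
have Ep : par a1 = par a.
  by apply: (share_path sh aW ai pp pW) => //; rewrite !inE eqxx orbT.
have [//|||||||S lS cS] := @chord_leafless _ e _ (par a) a1 us cs.
- by rewrite mem_head.
- by rewrite !inE eqxx !orbT.
- by rewrite -Ep; have [] := @parP i.-1 a1; rewrite ?prednK.
- by rewrite eq_sym; apply: low; rewrite !inE eqxx !orbT.
- move: us; rewrite [uniq _]/= !inE !negb_or.
  by case/and3P => _ /and5P[_ aa1 _ _ _] _; rewrite /= eqxx.
- move: us; rewrite [uniq _]/= !inE !negb_or.
  case/and3P => /and5P[_ _ pa1 pb2 _] /and5P[_ aa1 _ _ _] /andP[/and3P[ba1 _ _] _].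
  by rewrite /= !(eq_sym a1) (negbTE pa1) (negbTE aa1) (negbTE ba1) eqxx eq_sym.
exists S => //; rewrite cS /= in sp *; clear -sp; lia.
Qed.

End LayeredCycles.

(** * Nine edges from layers two and three *)

Section NineEdges.
Variables (V : finType) (e : rel V) (col : V -> bool) (x : V) (par : V -> V).
Hypothesis esym : symmetric e.
Hypothesis bip : forall u v, e u v -> col u != col v.
Local Notation layer := (layer e x).
Hypothesis parP : forall i v, v \in layer i.+1 -> par v \in layer i /\ e (par v) v.
Variables (D : nat) (W : {set V}).
Hypothesis sW : W \subset layer 2 :|: layer 3.
Hypothesis core : forall v, v \in W -> D < #|nbr e W v|.

(** Some [b] has neighbours [a], [a'] with different parents. The parent of a third neighbour [w] is
    either new, giving a theta graph, or one of these two, giving an 8-cycle with a chord. *)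
Lemma core_nine_edges : 5 <= D -> ~ share e x par 2 W 1 ->
  exists2 S, leafless e S & #|S| = 9.
Proof.
move=> D5 nsh.
have [b [a [a' [bW bi ab a'b ne]]]] : exists b a a', [/\ b \in W, b \in layer 3,
    a \in nbr e W b, a' \in nbr e W b & par a != par a'].
  apply: contrapT => H; apply: nsh => b a a' bW bi ab a'b; apply/eqP/negPn/negP => ne.
  by apply: H; exists b, a, a'.
have [w] : exists w, w \in nbr e W b :\: [set a; a'].
  apply/set0Pn; rewrite -card_gt0 cardsD subn_gt0.
  apply: leq_ltn_trans (subset_leq_card (subsetIr _ _)) _.
  apply: leq_ltn_trans (core bW); rewrite cards2; case: (a != a') => //.
    by apply: leq_trans D5.
  by apply: leq_trans D5.
rewrite !inE negb_or => /andP[/andP[wa wa'] /andP[wW bw]].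
have aa' : a != a' by apply: contraNneq ne => ->.
move: ab a'b; rewrite !inE => /andP[aW ba] /andP[a'W ba'].
have down v : v \in W -> e b v -> v \in layer 2.
  by move=> vW bv; apply: (core_edge' bip sW bi vW bv).
have [ai a'i wi] := And3 (down _ aW ba) (down _ a'W ba') (down _ wW bw).
have up v : v \in layer 2 -> [/\ par v \in layer 1, e (par v) v, e v (par v), e x (par v) & e (par v) x].
  move=> /parP[pv pe]; have [] := parP pv; rewrite {1}/layer inE => /eqP-> xp.
  by split=> //; rewrite esym.
have x0 : x \in layer 0 by rewrite inE.
have nl := @neq_lay V e x.
have [pa1 pae pae' xpa pax] := up _ ai; have [pa'1 pa'e pa'e' xpa' pa'x] := up _ a'i.
have [pw1 pwe pwe' xpw pwx] := up _ wi.
have ab' : e a b by rewrite esym.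
have a'b' : e a' b by rewrite esym.
have wb : e w b by rewrite esym.
have [wne|] := boolP ((par w != par a) && (par w != par a')).
  case/andP: wne => wa1 wa1'.
  (* Of the three paths of length 3 from [b] to [x], two form this 6-cycle; the third, through [w],
     is the ear. *)
  pose s := [:: x; par a; a; b; a'; par a'].
  have us : uniq s.
    rewrite /= !inE !negb_or aa' ne (nl 0 1) // (nl 0 2 x a) // (nl 0 3 x b) //.
    rewrite (nl 0 2 x a') // (nl 0 1 x (par a')) // (nl 1 2 _ a) // (nl 1 3 _ b) //.
    rewrite (nl 1 2 _ a') // (nl 2 3 a b) // (nl 2 1 a) // (nl 3 2 b a') //.
    by rewrite (nl 3 1 b) // (nl 2 1 a').
  have cs : cycle e s by rewrite /= xpa pae ab' ba' pa'e' pa'x.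
  have [ls cards] := cycle_leafless us cs isT.
  have wncov v : v \notin s -> v \notin cover (cycle_edges s).
    apply: contraNN => /bigcupP[f /imsetP[t ts ->]].
    by case/set2P => ->; rewrite ?mem_next.
  have [||||||||S lS cS] := @leafless_ear _ e _ b x w (par w) ls.
  - by apply: mem_cover_cycle_edges; rewrite !inE eqxx !orbT.
  - by apply: mem_cover_cycle_edges; rewrite !inE eqxx.
  - apply: wncov; rewrite !inE !negb_or wa wa' (nl 2 0 w) // (nl 2 1 w) //.
    by rewrite (nl 2 3 w) // (nl 2 1 w).
  - apply: wncov; rewrite !inE !negb_or wa1 wa1' (nl 1 0 _ x) // (nl 1 2 _ a) //.
    by rewrite (nl 1 3 _ b) // (nl 1 2 _ a').
  - by rewrite (nl 2 1 w).
  - exact: bw.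
  - exact: pwe'.
  - exact: pwx.
  by exists S => //; rewrite cS cards.
(* Here [c] is the one of [a], [a'] that shares its parent with [w]. The edge from [par c] to [w]
   will be the chord. *)
have chord_case c c' : c \in layer 2 -> c' \in layer 2 -> c \in W -> c' \in W ->
    e b c -> e b c' -> par c != par c' -> w != c -> w != c' -> par w = par c ->
    exists2 S, leafless e S & #|S| = 9.
  move=> ci c'i cW c'W bc bc' nec wc wc' Epw.
  have cc' : c != c' by apply: contraNneq nec => ->.
  have [|p [pp sp upp pW pX]] := @long_path _ e D 2 W (b |: [set c; c']) w core wW.
    rewrite cardsU1 cards2; apply: leq_trans D5.
    by case: (c != c'); case: (b \notin _).
  case: p sp pp upp pW pX => [|b' [|y [|//]]] //= _ /and3P[wb' b'y _].
  rewrite !inE negb_or => /and3P[/andP[nwb' nwy] nb'y _] pW pX.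
  have b'W : b' \in W by apply: pW; rewrite !inE eqxx.
  have yW : y \in W by apply: pW; rewrite !inE eqxx orbT.
  have b'i := core_edge bip sW wi b'W wb'.
  have yi := core_edge' bip sW b'i yW b'y.
  have := pX b'; rewrite !inE eqxx => /(_ isT); rewrite !negb_or => /and3P[b'b _ _].
  have := pX y; rewrite !inE eqxx orbT => /(_ isT); rewrite !negb_or => /and3P[_ yc yc'].
  have [pc1 pce pce' xpc pcx] := up _ ci; have [pc'1 pc'e pc'e' xpc' pc'x] := up _ c'i.
  have [py1 pye pye' xpy pyx] := up _ yi.
  have cb : e c b by rewrite esym.
  have c'b : e c' b by rewrite esym.
  (* The 8-cycle returns from [y] to the root through [par y], so its other branch must use
     whichever of [c], [c'] has a different parent. In both cases [par c] lies on the cycle. *)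
  have [Ey|Ney] := eqVneq (par y) (par c).
    pose s := [:: x; par c'; c'; b; w; b'; y; par c].
    have us : uniq s.
      rewrite /= !inE !negb_or (eq_sym c' w) wc' (eq_sym c' y) yc' nwy (eq_sym b b') b'b (eq_sym (par c') (par c)) nec.
      rewrite (nl 0 1 x (par c')) // (nl 0 2 x c') // (nl 0 3 x b) // (nl 0 2 x w) // (nl 0 3 x b') //.
      rewrite (nl 0 2 x y) // (nl 0 1 x (par c)) // (nl 1 2 _ c') // (nl 1 3 _ b) //.
      rewrite (nl 1 2 _ w) // (nl 1 3 _ b') // (nl 1 2 _ y) // (nl 2 3 c' b) //.
      rewrite (nl 2 3 c' b') // (nl 2 1 c') // (nl 3 2 b w) // (nl 3 2 b y) // (nl 3 1 b) //.
      rewrite (nl 2 3 w b') // (nl 2 1 w) // (nl 3 2 b' y) // (nl 3 1 b') //.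
      by rewrite (nl 2 1 y).
    have cs : cycle e s by rewrite /= xpc' pc'e c'b bw wb' b'y -Ey pye' pyx.
    have nw : next s w = b'.
      by rewrite /= (negbTE (nl 2 0 w x _ _ _)) // (negbTE (nl 2 1 w (par c') _ _ _)) // (negbTE wc')
        (negbTE (nl 2 3 w b _ _ _)) // eqxx.
    have npc : next s (par c) = x.
      rewrite /= (negbTE (nl 1 0 _ x _ _ _)) // (negbTE nec) (negbTE (nl 1 2 _ c' _ _ _)) //
        (negbTE (nl 1 3 _ b _ _ _)) // (negbTE (nl 1 2 _ w _ _ _)) //
        (negbTE (nl 1 3 _ b' _ _ _)) // (negbTE (nl 1 2 _ y _ _ _)) //.
      by rewrite eqxx.
    have [//|||||||S lS cS] := @chord_leafless _ e s (par c) w us cs.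
    - by rewrite !inE eqxx !orbT.
    - by rewrite !inE eqxx !orbT.
    - by rewrite -Epw.
    - by rewrite (nl 1 2 _ w).
    - by rewrite npc (nl 0 2 x w).
    - by rewrite nw (nl 3 1 b').
    by exists S.
  pose s := [:: x; par c; c; b; w; b'; y; par y].
  have us : uniq s.
    rewrite /= !inE !negb_or (eq_sym c w) wc (eq_sym c y) yc nwy (eq_sym b b') b'b (eq_sym (par c) (par y)) Ney.
    rewrite (nl 0 1 x (par c)) // (nl 0 2 x c) // (nl 0 3 x b) // (nl 0 2 x w) // (nl 0 3 x b') //.
    rewrite (nl 0 2 x y) // (nl 0 1 x (par y)) // (nl 1 2 _ c) // (nl 1 3 _ b) //.
    rewrite (nl 1 2 _ w) // (nl 1 3 _ b') // (nl 1 2 _ y) // (nl 2 3 c b) //.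
    rewrite (nl 2 3 c b') // (nl 2 1 c) // (nl 3 2 b w) // (nl 3 2 b y) // (nl 3 1 b) //.
    rewrite (nl 2 3 w b') // (nl 2 1 w) // (nl 3 2 b' y) // (nl 3 1 b') //.
    by rewrite (nl 2 1 y).
  have cs : cycle e s by rewrite /= xpc pce cb bw wb' b'y pye' pyx.
  have nw : next s w = b'.
    by rewrite /= (negbTE (nl 2 0 w x _ _ _)) // (negbTE (nl 2 1 w (par c) _ _ _)) // (negbTE wc)
      (negbTE (nl 2 3 w b _ _ _)) // eqxx.
  have npc : next s (par c) = c.
    by rewrite /= (negbTE (nl 1 0 _ x _ _ _)) // eqxx.
  have [//|||||||S lS cS] := @chord_leafless _ e s (par c) w us cs.
  - by rewrite !inE eqxx !orbT.
  - by rewrite !inE eqxx !orbT.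
  - by rewrite -Epw.
  - by rewrite (nl 1 2 _ w).
  - by rewrite npc eq_sym.
  - by rewrite nw (nl 3 1 b').
  by exists S.
rewrite negb_and !negbK => /orP[]/eqP Ew.
  exact: (chord_case a a').
by apply: (chord_case a' a) => //; rewrite eq_sym.
Qed.

End NineEdges.

(** The pairs with [m = 2 * r] stand for the 4-, 6- and 10-cycle; 7 and 9 edges are forced at the
    same density as 4 and 6. *)
Definition growth_pair (r m : nat) : Prop :=
  (r, m) \in [:: (2, 4); (2, 7); (3, 6); (3, 9); (5, 10)].

Lemma dense_leafless (V : finType) (e : rel V) (col : V -> bool) (r m K : nat) :
  symmetric e -> (forall u v, e u v -> col u != col v) -> growth_pair r m ->
  0 < K -> #|V| < K ^ r ->
  (2 * (12 * (K + 3))) * #|V| < \sum_(v : V) #|nbr e [set: V] v| ->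
  exists2 S, leafless e S & #|S| = m.
Proof.
move=> esym bip rm K0 VK dense.
(* The 10-cycle needs degree bound [2 * r + 2 = 12]; all the other patterns need less. *)
have [|W' [_ W'0 core']] := @dense_core _ _ esym (12 * (K + 3)) [set: V] (bip_irr bip).
  by rewrite cardsT; under eq_bigl => v do rewrite inE.
pose e' : rel V := fun u v => [&& e u v, u \in W' & v \in W'].
have e'e u v : e' u v -> e u v by case/and3P.
have e'sym : symmetric e' by move=> u v; rewrite /e' esym [(u \in W') && _]andbC.
have e'bip u v : e' u v -> col u != col v by move=> /e'e/bip.
have [x xW] := set0Pn _ W'0.
have mindeg v : v \in W' -> 12 * (K + 3) <= #|nbr e' [set: V] v|.
  move=> vW; apply: leq_trans (ltnW (core' v vW)) _; apply: subset_leq_card.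
  by apply/subsetP => u; rewrite !inE /= /e' vW => /andP[-> ->].
have [|i [W [ir sW W0 core]]] :=
    @layered_core V e' col x e'sym e'bip 12 K r isT K0 VK _ (mindeg x xW).
  by move=> u v /and3P[_ uW _]; apply: mindeg.
suff [S [S1 S2] cS] : exists2 S, leafless e' S & #|S| = m.
  by exists S => //; split=> // f /S1[u [v [/e'e uv ->]]]; exists u, v.
have [par parP] := exists_parent e' x.
have [i0 ir'] := andP ir.
have even_case : 2 * r = m -> 2 * r + 2 <= 12 -> exists2 S, leafless e' S & #|S| = m.
  move=> <- rD; have [s [us cs ss]] := core_even_cycle e'sym e'bip parP sW W0 core ir rD.
  have [|ls cs'] := cycle_leafless us cs; last by exists (cycle_edges s); rewrite ?cs' ?ss.
  by rewrite ss; move: i0 ir'; clear; lia.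
have shared (l : nat) : share e' x par i W 1 -> 1 < l -> 2 * l <= 12 ->
    exists2 S, leafless e' S & #|S| = 2 * l + 3.
  move=> sh l1 lD; exact (core_common_parent e'sym e'bip parP sW W0 core i0 sh l1 lD).
(* Vertices of layer 1 all have the root as parent. For [r = 2] this is the only case; for [r = 3]
   the case [i = 2] without sharing is left to [core_nine_edges]. *)
have share1 : i = 1 -> share e' x par i W 1.
  move=> E b a a' bW bi; rewrite !inE => /andP[aW ba] /andP[a'W ba'] /=.
  have root v : v \in W -> e' b v -> par v = x.
    move=> vW bv; have := core_edge' e'bip sW bi vW bv; rewrite E.
    by move=> /parP[]; rewrite inE => /eqP.
  by rewrite !root.
move: rm even_case shared; rewrite /growth_pair !inE !xpair_eqE.
case/or4P => [|||/orP[|]] /andP[/eqP Er /eqP Em]; rewrite Er Em => even_case shared.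
- exact: even_case.
- apply: (shared 2) => //; apply: share1.
  by move: ir; rewrite Er; clear; case: i => [|[|i]].
- exact: even_case.
- have [sh|nsh] := pselect (share e' x par i W 1); first exact: (shared 3).
  have Ei : i = 2.
    have : i <> 1 by move=> /share1.
    by move: ir; rewrite Er; clear; case: i => [|[|[|i]]].
  move: sW nsh core; rewrite Ei => sW2 nsh2 core2.
  exact: (core_nine_edges e'sym e'bip parP sW2 core2 _ nsh2).
- exact: even_case.
Qed.

(** * From coloured pairs to graphs on the colours *)

Section Pairs.
Variables (N k : nat) (a b : 'I_N -> 'I_k).

(** Repetition on the same side of the pairs is more than a conflict requires, but it is what a
    leafless set of a bipartite graph provides. *)
Definition repeating (I : {set 'I_N}) : Prop := forall i, i \in I ->
  (exists i', [/\ i' \in I, i' != i & a i' = a i]) /\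
  (exists i', [/\ i' \in I, i' != i & b i' = b i]).

Definition pairs : {set 'I_k * 'I_k} := [set (a i, b i) | i in 'I_N].

(** By pigeonhole some value is taken at least [m] times, and [m] equal pairs repeat one another on
    both sides. *)
Lemma parallel_pairs (m : nat) : 1 < m -> m * #|pairs| < N ->
  exists2 I, repeating I & #|I| = m.
Proof.
move=> m1 mN.
have [p pE pm] : exists2 p, p \in pairs & m <= #|[set i | (a i, b i) == p]|.
  apply/exists_inP; apply: contraLR mN => /exists_inPn H; rewrite -leqNgt.
  have EN : N = \sum_(i < N) 1 by rewrite sum1_card card_ord.
  rewrite [X in X <= _]EN (partition_big (fun i => (a i, b i)) (mem pairs)) /=.
    rewrite mulnC -sum_nat_const; apply: leq_sum => p /H; rewrite -ltnNge => /ltnW.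
    by apply: leq_trans; rewrite -sum1_card; apply: eq_leq; apply: eq_bigl => i; rewrite inE.
  by move=> i _; apply: imset_f.
have /card_geqP[s [us ss sI]] := pm.
have cI : #|[set i in s]| = m by rewrite cardsE (card_uniqP us).
exists [set i in s] => // i iI.
have : 0 < #|[set i in s] :\ i|.
  by move: cI; rewrite (cardsD1 i) iI add1n => E; rewrite -ltnS E.
case/card_gt0P => j; rewrite in_setD1 => /andP[ji jI].
have Ep l : l \in [set i in s] -> (a l, b l) = p by rewrite inE => /sI; rewrite inE => /eqP.
have [Ea Eb] : a j = a i /\ b j = b i.
  by move: (Ep j jI) (Ep i iI) => <- [-> ->].
by split; exists j.
Qed.

(* Colours are doubled according to the side of the pair they colour: this makes the graph
   bipartite and turns monochromatic pairs into ordinary edges. *)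
Definition color_graph : rel ('I_k + 'I_k) := fun u v =>
  match u, v with
  | inl c, inr c' => (c, c') \in pairs
  | inr c', inl c => (c, c') \in pairs
  | _, _ => false
  end.

(** One index is chosen for each edge of [S]; the second edge at a vertex then supplies the second
    index with that colour. *)
Lemma leafless_repeating (S : {set {set 'I_k + 'I_k}}) :
  leafless color_graph S -> exists2 I, repeating I & #|I| = #|S|.
Proof.
move=> [S1 S2].
have idx f : f \in S -> exists i, f = [set inl (a i); inr (b i)].
  move=> /S1[u [v [uv ->]]].
  by case: u v uv => [c|c] [c'|c'] //= /imsetP[i _ [-> ->]]; exists i; rewrite // setUC.
pose ed i : {set 'I_k + 'I_k} := [set inl (a i); inr (b i)].
have inl_ed i c : inl c \in ed i -> a i = c by rewrite !inE => /orP[/eqP[]|/eqP].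
have inr_ed i c : inr c \in ed i -> b i = c by rewrite !inE => /orP[/eqP|/eqP[]].
(* An option, because ['I_N] may be empty and offer no default. *)
have ed_choice : exists g : {set 'I_k + 'I_k} -> option 'I_N,
    forall f, f \in S -> exists2 i, g f = Some i & f = ed i.
  suff /choice[g gP] : forall f, exists o, f \in S -> exists2 i, o = Some i & f = ed i by exists g.
  move=> f; have [/idx[i Ei]|_] := boolP (f \in S); last by exists None.
  by exists (Some i) => _; exists i.
have [g gP] := ed_choice.
have ginj : {in S &, injective g}.
  move=> f f' /gP[i Ei Ef] /gP[i' Ei' Ef']; rewrite Ei Ei' => -[Eii].
  by rewrite Ef Ef' Eii.
pose I := [set i | Some i \in g @: S].
have memI i : i \in I -> ed i \in S /\ g (ed i) = Some i.
  rewrite inE => /imsetP[f fS E]; have [j Ej Ef] := gP f fS.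
  by move: E; rewrite Ej => -[->]; rewrite -Ef Ej.
have Imem f i : f \in S -> g f = Some i -> i \in I.
  by move=> fS E; rewrite inE -E; apply: imset_f.
exists I; last first.
  rewrite -(card_in_imset ginj) -(card_imset (mem I) (@Some_inj _)).
  apply: eq_card => o; apply/imsetP/idP => [[i iI ->]|].
    by move: iI; rewrite inE.
  case/imsetP => f fS ->; have [i Ei _] := gP f fS; exists i => //.
  exact: Imem Ei.
have other i v : i \in I -> v \in ed i -> exists i', [/\ i' \in I, i' != i & v \in ed i'].
  move=> iI vi; have [iS gi] := memI i iI.
  have [f' [f'S ne vf']] := S2 _ _ iS vi; have [i' Ei' Ef'] := gP f' f'S.
  exists i'; split; [exact: Imem Ei'| |by rewrite -Ef'].
  by apply: contraNneq ne => <-; rewrite Ef'.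
move=> i iI; split.
  have [|i' [i'I ne vi']] := other i (inl (a i)) iI; first by rewrite !inE eqxx.
  by exists i'; split=> //; apply: inl_ed.
have [|i' [i'I ne vi']] := other i (inr (b i)) iI; first by rewrite !inE eqxx orbT.
by exists i'; split=> //; apply: inr_ed.
Qed.

Lemma card_pairs_nbr : #|pairs| <= \sum_(v : 'I_k + 'I_k) #|nbr color_graph [set: _] v|.
Proof.
have inj : injective (fun p : 'I_k * 'I_k => (inl p.1, inr p.2) : ('I_k + 'I_k) * ('I_k + 'I_k)).
  by move=> [c c'] [d d'] [-> ->].
rewrite -(card_imset (mem pairs) inj).
have -> : \sum_(v : 'I_k + 'I_k) #|nbr color_graph [set: _] v| =
    #|[set p : ('I_k + 'I_k) * ('I_k + 'I_k) | color_graph p.1 p.2]|.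
  rewrite -sum1_card (eq_bigl (fun p => true && color_graph p.1 p.2)); last by move=> p; rewrite inE.
  rewrite -(pair_big_dep xpredT (fun u v => color_graph u v) (fun _ _ => 1)) /=.
  apply: eq_bigr => u _; rewrite -sum1_card; apply: eq_bigl => v.
  by rewrite !inE.
apply: subset_leq_card; apply/subsetP => q /imsetP[[c c'] cc' ->].
by rewrite inE.
Qed.

End Pairs.

(** For [r = 1] the trivial bound of [k ^ 2] distinct pairs suffices, and the pattern is one pair
    taken [m] times. *)
Definition exponent_pair (r m : nat) : Prop :=
  growth_pair r m \/ (r = 1 /\ 1 < m).

(** Otherwise [N <= m * #|pairs a b|], and the graph on [2 * k] doubled colours is too sparse for
    [dense_leafless] at the least [K] with [2 * k < K ^ r]. The constants collect
    [48 * (K + 3) <= 240 * (K - 1)], the multiplicity [m] and [(K - 1) ^ r <= 2 * k]. *)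
Lemma repeating_pairs (r m N k : nat) (a b : 'I_N -> 'I_k) :
  exponent_pair r m -> 0 < k -> 2 * (240 * m) ^ r * k ^ r.+1 < N ^ r ->
  exists2 I, repeating a b I & #|I| = m.
Proof.
move=> rm k0 big; apply: contrapT => none.
have m1 : 1 < m.
  case: rm => [|[]//]; rewrite /growth_pair !inE !xpair_eqE.
  by case/or4P => [|||/orP[|]] /andP[_ /eqP->].
have Nm : N <= m * #|pairs a b|.
  by rewrite leqNgt; apply/negP => /(parallel_pairs m1).
case: rm => [rm|[r1 _]]; last first.
  move: big; rewrite r1 !expn1 ltnNge; case/negP.
  apply: leq_trans Nm _; rewrite -mulnn.
  have : #|pairs a b| <= k * k by rewrite (leq_trans (max_card _)) // card_prod !card_ord.
  by move: #|pairs a b| => p; clear; nia.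
have r0 : 0 < r.
  move: rm; rewrite /growth_pair !inE !xpair_eqE.
  by case/or4P => [|||/orP[|]] /andP[/eqP-> _].
have [K [Kk Kmin]] : exists K, 2 * k < K ^ r /\ forall L, 2 * k < L ^ r -> K <= L.
  have ex : exists K, 2 * k < K ^ r.
    exists (2 * k).+1; apply: (@leq_trans ((2 * k).+1 ^ 1)); first by rewrite expn1.
    by rewrite leq_pexp2l.
  by case: (ex_minnP ex) => K K1 K2; exists K.
have K2 : 2 <= K.
  case: K Kk {Kmin} => [|[|K]] //; rewrite ?exp1n; last by clear -k0; lia.
  by case: (r) => [|r']; rewrite ?expn0 ?exp0n //; clear -k0; lia.
case: K Kk Kmin K2 => [|[|L]] // Kk Kmin _.
have Kpred : L.+1 ^ r <= 2 * k.
  by rewrite leqNgt; apply/negP => /Kmin; rewrite ltnn.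
have few : #|pairs a b| <= (2 * (12 * (L.+2 + 3))) * (2 * k).
  rewrite leqNgt; apply/negP => lt; apply: none.
  have [|||||S lS <-] := @dense_leafless _ (color_graph a b)
    (fun u => if u is inl _ then true else false) r m L.+2 _ _ rm.
  - by case=> [c|c] [d|d].
  - by case=> [c|c] [d|d].
  - by [].
  - by rewrite card_sum card_ord addnn -mul2n.
  - apply: leq_trans (card_pairs_nbr a b).
    by rewrite card_sum card_ord addnn -mul2n.
  exact: leafless_repeating.
move: big; rewrite ltnNge; case/negP.
have NK : N <= (240 * m) * L.+1 * k.
  apply: leq_trans Nm _; apply: leq_trans (leq_mul (leqnn m) few) _.
  have : L.+2 + 3 <= 5 * L.+1 by clear; lia.
  move: (L.+2 + 3) (L.+1) => x y xy; rewrite -!mulnA [240 * _]mulnCA leq_mul2l; apply/orP; right.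
  by clear -xy; nia.
have := NK; rewrite -(leq_exp2r _ _ r0) => /leq_trans; apply.
rewrite !expnMn (expnS k).
have := leq_mul (leqnn (240 ^ r * m ^ r * k ^ r)) Kpred.
move: (240 ^ r * m ^ r) (L.+1 ^ r) (k ^ r) => X Y Z; clear; lia.
Qed.

(** * Colourings along trails *)

Section Trails.
Variable V : finType.

Fixpoint trail_edges (x : V) (p : seq V) : seq {set V} :=
  if p is y :: p' then [set x; y] :: trail_edges y p' else [::].

Definition trails_edges (tt : seq (V * seq V)) : seq {set V} :=
  flatten [seq trail_edges t.1 t.2 | t <- tt].

Lemma size_trail_edges x p : size (trail_edges x p) = size p.
Proof. by elim: p x => //= y p IH x; rewrite IH. Qed.

Lemma trail_edges_cat x p q :
  trail_edges x (p ++ q) = trail_edges x p ++ trail_edges (last x p) q.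
Proof. by elim: p x => //= y p IH x; rewrite IH. Qed.

Lemma last_rev_belast (x : V) p : last (last x p) (rev (belast x p)) = x.
Proof. by case: p => //= y p; rewrite rev_cons last_rcons. Qed.

Lemma trail_edges_rev x p :
  perm_eq (trail_edges (last x p) (rev (belast x p))) (trail_edges x p).
Proof.
elim: p x => //= y p IH x; rewrite rev_cons -cats1 trail_edges_cat last_rev_belast /=.
by rewrite perm_catC /= setUC perm_cons.
Qed.

(* Two trails starting at the same vertex can be glued, so in a shortest list the
   starting vertices are distinct. *)
Lemma insert_trail (tt : seq (V * seq V)) x p : uniq [seq t.1 | t <- tt] ->
  exists2 tt', uniq [seq t.1 | t <- tt'] &
    perm_eq (trails_edges tt') (trail_edges x p ++ trails_edges tt).
Proof.
have [n] := ubnP (size tt); elim: n tt x p => // n IH tt x p szn ut.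
have [/mapP[[x' p'] tin /= Ex]|xn] := boolP (x \in [seq t.1 | t <- tt]); last first.
  by exists ((x, p) :: tt); rewrite /= ?xn.
rewrite -{x'}Ex in tin; case/splitPr: tin szn ut => t1 t2 szn ut.
have [||tt' ut' pe] := IH (t1 ++ t2) (last x p) (rev (belast x p) ++ p').
- by move: szn; rewrite !size_cat /= addnS.
- move: ut; rewrite !map_cat /= !cat_uniq /= negb_or.
  by case/and3P => -> /andP[_ ->] /andP[_ ->].
exists tt' => //; apply: perm_trans pe _.
rewrite trail_edges_cat last_rev_belast /trails_edges !map_cat !flatten_cat /=.
rewrite -!catA; apply: perm_cat; first exact: trail_edges_rev.
by rewrite perm_catCA.
Qed.

(** Edges are inserted one by one as trails of length 1. Distinct starts let the starting vertex
    serve as the name of a separator. *)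
Lemma trail_decomposition (E : seq {set V}) :
  (forall f, f \in E -> exists u v, f = [set u; v]) ->
  exists2 tt, uniq [seq t.1 | t <- tt] & perm_eq (trails_edges tt) E.
Proof.
elim: E => [|f E IH] EP; first by exists [::].
have [|tt ut pe] := IH; first by move=> g gE; apply: EP; rewrite inE gE orbT.
have [u [v Ef]] := EP f (mem_head _ _).
have [tt' ut' pe'] := insert_trail u [:: v] ut; exists tt' => //.
by apply: perm_trans pe' _; rewrite /= -Ef perm_cons.
Qed.

(* [inl v] is an ordinary occurrence of the vertex v; [inr x] is the separator placed
   in front of the trail starting at x, so that it occurs only once. *)
Definition trails_word (tt : seq (V * seq V)) : seq (V + V) :=
  flatten [seq inr t.1 :: map inl (t.1 :: t.2) | t <- tt].

Fixpoint word_edges (w : seq (V + V)) : seq {set V} :=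
  if w is a :: w' then
    (match a, w' with inl u, inl v :: _ => [:: [set u; v]] | _, _ => [::] end)
      ++ word_edges w'
  else [::].

Definition word_seps (w : seq (V + V)) : seq V :=
  pmap (fun a : V + V => if a is inr x then Some x else None) w.

Lemma word_edges_trails tt : word_edges (trails_word tt) = trails_edges tt.
Proof.
rewrite /trails_word /trails_edges; elim: tt => [//|[x p] tt IH] /=.
elim: p x => [|y p IHp] x /=; last by rewrite IHp.
by rewrite IH; case: (tt).
Qed.

Lemma word_seps_trails tt : word_seps (trails_word tt) = [seq t.1 | t <- tt].
Proof.
rewrite /trails_word /word_seps; elim: tt => [//|[x p] tt IH] /=.
by rewrite pmap_cat IH; elim: p.
Qed.

Lemma size_trails_word tt : size (trails_edges tt) <= size (trails_word tt).
Proof.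
rewrite /trails_edges /trails_word; elim: tt => [//|[x p] tt IH] /=.
rewrite !size_cat size_map size_trail_edges -!addSn; apply: leq_add IH.
exact: leq_trans (leqnSn _) (leqnSn _).
Qed.

Variable a0 : V + V.

Lemma word_edges_mem w i u v : nth a0 w i = inl u -> nth a0 w i.+1 = inl v ->
  i.+1 < size w -> [set u; v] \in word_edges w.
Proof.
elim: w i => [//|a w IH] [|i] /=.
  by move=> ->; case: w {IH} => [|b w] //= -> _; rewrite inE eqxx.
by move=> nu nv sz; rewrite mem_cat (IH i) ?orbT.
Qed.

Lemma word_edges_index w i i' u v u' v' : uniq (word_edges w) ->
  i.+1 < size w -> i'.+1 < size w ->
  nth a0 w i = inl u -> nth a0 w i.+1 = inl v ->
  nth a0 w i' = inl u' -> nth a0 w i'.+1 = inl v' ->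
  [set u; v] = [set u'; v'] -> i = i'.
Proof.
have head b w1 j y z y' z' : uniq (word_edges (inl y :: inl z :: w1)) ->
    j.+1 < size (inl z :: w1) -> nth b (inl z :: w1) j = inl y' ->
    nth b (inl z :: w1) j.+1 = inl z' -> b = a0 -> [set y; z] <> [set y'; z'].
  move=> us sz n1 n2 Eb E; rewrite Eb in n1 n2.
  have := word_edges_mem n1 n2 sz; rewrite -E => yz.
  have Ew : word_edges (inl y :: inl z :: w1) = [set y; z] :: word_edges (inl z :: w1) by [].
  by move: us; rewrite Ew cons_uniq yz.
elim: w i i' => [//|a w IH] [|i] [|i'] // us sz sz'.
- move=> /= Ea; case: w us sz sz' {IH} => [//|b w] us sz sz' /= Eb; rewrite Ea Eb in us.
  by move=> n1 n2 /(@head a0 w i' u v u' v' us); case; rewrite // -Eb.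
- move=> n1 n2 /= Ea; case: w us sz sz' n1 n2 {IH} => [//|b w] us sz sz' n1 n2 /= Eb; rewrite Ea Eb in us.
  move=> E; case: (@head a0 w i u' v' u v us) => //; try by rewrite -Eb.
- move=> /= n1 n2 n3 n4 E; congr _.+1; apply: (IH i i') E => //.
  by move: us; rewrite /= cat_uniq => /and3P[].
Qed.

Lemma word_seps_index w i i' x : uniq (word_seps w) -> i < size w -> i' < size w ->
  nth a0 w i = inr x -> nth a0 w i' = inr x -> i = i'.
Proof.
have mem w1 j : j < size w1 -> nth a0 w1 j = inr x -> x \in word_seps w1.
  move=> sz E; rewrite mem_pmap; apply/mapP; exists (inr x) => //.
  by rewrite -E mem_nth.
elim: w i i' => [//|a w IH] [|i] [|i'] //= us sz sz' Ea Eb.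
- by move: us; rewrite Ea /= (mem w i').
- by move: us; rewrite Eb /= (mem w i).
- by congr _.+1; apply: IH => //; move: us; case: a => // y /=; case/andP.
Qed.

End Trails.

Section TrailColoring.
Variables (V : finType) (e : rel V).
Hypothesis eirr : irreflexive e.

Definition graph_edges : {set {set V}} :=
  [set [set p.1; p.2] | p in [set p : V * V | e p.1 p.2]].

(** The separator at position 0 settles every set containing the first point. Indexing by [nat] lets
    [i.+1] be written without a bound. *)
Definition trail_coloring (n : nat) (c : nat -> V + V) : Prop :=
  [/\ (exists x, c 0 = inr x),
      (forall i i' x, i < n -> i' < n -> c i = inr x -> c i' = inr x -> i = i'),
      (forall i u v, i.+1 < n -> c i = inl u -> c i.+1 = inl v -> e u v || e v u) &
      (forall i i' u v u' v', i.+1 < n -> i'.+1 < n -> c i = inl u -> c i.+1 = inl v ->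
         c i' = inl u' -> c i'.+1 = inl v' -> [set u; v] = [set u'; v'] -> i = i')].

Lemma exists_trail_coloring (n : nat) : 0 < n -> n <= #|graph_edges| ->
  exists c, trail_coloring n c.
Proof.
move=> n0 nE.
have [|tt ut pe] := @trail_decomposition V (enum graph_edges).
  by move=> f; rewrite mem_enum => /imsetP[[u v] _ ->]; exists u, v.
have nw : n <= size (trails_word tt).
  apply: leq_trans (size_trails_word tt).
  by rewrite (perm_size pe) -cardE.
have us : uniq (word_seps (trails_word tt)) by rewrite word_seps_trails.
have ue : uniq (word_edges (trails_word tt)).
  by rewrite word_edges_trails (perm_uniq pe) enum_uniq.
case Ett: tt => [|[x p] tt']; first by move: nw; rewrite Ett; case: (n) n0.
exists (nth (inr x) (trails_word tt)); split.
- by exists x; rewrite Ett.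
- by move=> i i' y ni ni'; apply: word_seps_index => //; apply: leq_trans nw.
- move=> i u v ni cu cv; have := word_edges_mem cu cv (leq_trans ni nw).
  rewrite word_edges_trails (perm_mem pe) mem_enum => /imsetP[[y z]].
  rewrite inE /= => yz E.
  have yz' : y != z by apply: contraTneq yz => ->; rewrite eirr.
  move/setP: E => E; have := E y; have := E z; rewrite !inE !eqxx !orbT.
  case/orP => /eqP Ez /orP[]/eqP Ey; move: yz yz'; rewrite Ey Ez.
  - by rewrite eqxx.
  - by move=> ->; rewrite orbT.
  - by move=> ->.
  - by rewrite eqxx.
- move=> i i' u v u' v' ni ni'; apply: word_edges_index => //; exact: leq_trans nw.
Qed.

End TrailColoring.

(** * Wenger graphs *)

From mathcomp Require Import all_algebra all_field.
From mathcomp Require Import ring.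
Import GRing.Theory.

(** * Counting incidences in leafless bipartite graphs *)

Section Incidence.
Variables (X Y : finType) (B : {set X * Y}).

Definition lines_at (p : X) : {set Y} := [set l | (p, l) \in B].
Definition points_at (l : Y) : {set X} := [set p | (p, l) \in B].
Definition pts : {set X} := [set q.1 | q in B].
Definition lns : {set Y} := [set q.2 | q in B].

Lemma row_lns p : lines_at p \subset lns.
Proof. by apply/subsetP => l; rewrite inE => pl; apply/imsetP; exists (p, l). Qed.

Lemma col_pts l : points_at l \subset pts.
Proof. by apply/subsetP => p; rewrite inE => pl; apply/imsetP; exists (p, l). Qed.

Lemma card_rows : #|B| = \sum_(p in pts) #|lines_at p|.
Proof.
rewrite -sum1_card (partition_big fst (mem pts)) /=; last by move=> q qB; apply: imset_f.
apply: eq_bigr => p _; rewrite sum1_card -(card_imset (mem (lines_at p)) (f := pair p)); last first.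
  by move=> l l' [].
apply: eq_card => -[p' l]; apply/andP/imsetP => [[pB /eqP <-]|[l' l'p [-> ->]]].
  by exists l; rewrite // inE.
by rewrite inE in l'p; rewrite -[_ \in _]/((p, l') \in B) l'p eqxx.
Qed.

Lemma card_cols : #|B| = \sum_(l in lns) #|points_at l|.
Proof.
rewrite -sum1_card (partition_big snd (mem lns)) /=; last by move=> q qB; apply: imset_f.
apply: eq_bigr => l _; rewrite sum1_card -(card_imset (mem (points_at l)) (f := pair^~ l)); last first.
  by move=> p p' [].
apply: eq_card => -[p l']; apply/andP/imsetP => [[pB /eqP <-]|[p' p'l [-> ->]]].
  by exists p; rewrite // inE.
by rewrite inE in p'l; rewrite -[_ \in _]/((p', l) \in B) p'l eqxx.
Qed.

(** A leafless edge set of a bipartite graph, read as a set of incidences. *)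
Definition thick : Prop := forall p l, (p, l) \in B -> 1 < #|lines_at p| /\ 1 < #|points_at l|.

Definition no_quadrangle : Prop := forall p p' l l',
  (p, l) \in B -> (p, l') \in B -> (p', l) \in B -> (p', l') \in B -> p = p' \/ l = l'.

Definition no_hexagon : Prop := forall p1 p2 p3 l1 l2 l3,
  (p1, l1) \in B -> (p1, l2) \in B -> (p2, l2) \in B -> (p2, l3) \in B ->
  (p3, l3) \in B -> (p3, l1) \in B -> l1 != l2 -> l2 != l3 -> l3 != l1 ->
  p1 = p2 \/ p2 = p3 \/ p3 = p1.

Section ThickFacts.
Hypothesis thickB : thick.

Lemma thick_row p : p \in pts -> 1 < #|lines_at p|.
Proof. by case/imsetP => -[p' l] pl ->; have [] := thickB pl. Qed.

Lemma thick_col l : l \in lns -> 1 < #|points_at l|.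
Proof. by case/imsetP => -[p l'] pl ->; have [] := thickB pl. Qed.

Lemma pts_bound : 2 * #|pts| <= #|B|.
Proof. by rewrite card_rows mulnC -sum_nat_const; apply: leq_sum => p /thick_row. Qed.

Lemma lns_bound : 2 * #|lns| <= #|B|.
Proof. by rewrite card_cols mulnC -sum_nat_const; apply: leq_sum => p /thick_col. Qed.

Lemma card_product_bound : #|B| <= #|pts| * #|lns|.
Proof.
rewrite card_rows -sum_nat_const; apply: leq_sum => p _.
exact: subset_leq_card (row_lns p).
Qed.

Lemma big_row d : d * #|pts| < #|B| -> exists2 p, p \in pts & d < #|lines_at p|.
Proof.
move=> big; apply/exists_inP; apply: contraLR big => /exists_inPn H.
rewrite -leqNgt card_rows mulnC -sum_nat_const; apply: leq_sum => p /H.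
by rewrite -leqNgt.
Qed.

Lemma other_point p l : (p, l) \in B -> exists2 p', p' != p & (p', l) \in B.
Proof.
move=> pl; have [_] := thickB pl; rewrite (cardsD1 p) inE pl /= ltnS.
by case/card_gt0P => p'; rewrite !inE => /andP[? ?]; exists p'.
Qed.

Lemma other_line p l : (p, l) \in B -> exists2 l', l' != l & (p, l') \in B.
Proof.
move=> pl; have [+ _] := thickB pl; rewrite (cardsD1 l) inE pl /= ltnS.
by case/card_gt0P => l'; rewrite !inE => /andP[? ?]; exists l'.
Qed.

(** A second line through a second point of a line at [p] misses [p]. *)
Lemma quadrangle_bound p : no_quadrangle -> p \in pts -> #|lines_at p| < #|lns|.
Proof.
move=> nq /imsetP[[p' l] pl /= Ep]; rewrite -{p'}Ep in pl.
have [p' p'p p'l] := other_point pl; have [l' l'l p'l'] := other_line p'l.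
have : l' \notin lines_at p.
  apply/negP; rewrite inE => pl'; have := nq _ _ _ _ pl pl' p'l p'l'.
  by case=> E; [move: p'p|move: l'l]; rewrite E eqxx.
move=> l'n; apply: proper_card; rewrite properE row_lns /=; apply/subsetPn; exists l' => //.
by apply/imsetP; exists (p', l').
Qed.

(** Each line at [p] carries another point, and through that another line. These new lines miss [p]
    and are pairwise distinct, since otherwise a quadrangle or a hexagon would close up. *)
Lemma hexagon_bound p : no_quadrangle -> no_hexagon -> 2 * #|lines_at p| <= #|lns|.
Proof.
move=> nq nh.
have next l : exists q, l \in lines_at p -> [/\ q.1 != p, (q.1, l) \in B, q.2 != l & (q.1, q.2) \in B].
  have [|nl] := boolP (l \in lines_at p); last by exists (p, l).
  rewrite inE => pl; have [p' p'p p'l] := other_point pl.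
  by have [l' l'l p'l'] := other_line p'l; exists (p', l').
have [z zP] : exists z : Y -> X * Y, forall l, l \in lines_at p ->
    [/\ (z l).1 != p, ((z l).1, l) \in B, (z l).2 != l & ((z l).1, (z l).2) \in B].
  exact: fin_all_exists next.
have zinj : {in lines_at p &, injective (fun l => (z l).2)}.
  move=> l l' lp l'p E; have [zp zl nzl zz] := zP l lp; have [zp' zl' nzl' zz'] := zP l' l'p.
  apply/eqP/negPn/negP => ll'; move: (lp) (l'p); rewrite !inE => pl pl'.
  have ne1 : (z l').1 != p by [].
  rewrite -E in zz' nzl'.
  have := nh p (z l').1 (z l).1 l l' (z l).2 pl pl' zl' zz' zz zl ll'.
  rewrite eq_sym nzl' nzl => /(_ isT isT)[E1|[E1|E1]].
  - by rewrite E1 eqxx in ne1.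
  - rewrite E1 in zl'; have := nq _ _ _ _ pl pl' zl zl'.
    by case=> E2; [move: zp; rewrite E2 eqxx|move: ll'; rewrite E2 eqxx].
  - by rewrite E1 eqxx in zp.
rewrite mul2n -addnn -{2}(card_in_imset zinj).
rewrite -cardsUI; have -> : lines_at p :&: [set (z l).2 | l in lines_at p] = set0.
  apply/setP => l; rewrite in_set0 in_setI; apply/negP => /andP[lp /imsetP[l' l'p El]].
  have [zp zl nzl zz] := zP l' l'p; move: lp l'p; rewrite El !inE => pz pl'.
  case: (nq _ _ _ _ pl' pz zl zz) => E; first by rewrite E eqxx in zp.
  by rewrite {2}E eqxx in nzl.
rewrite cards0 addn0; apply: subset_leq_card; rewrite subUset row_lns /=.
apply/subsetP => l /imsetP[l' l'p ->]; have [_ _ _ zz] := zP l' l'p.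
by apply/imsetP; exists ((z l').1, (z l').2).
Qed.

Lemma pts_gt0 : 0 < #|B| -> exists p, p \in pts.
Proof. by case/card_gt0P => -[p l] pl; exists p; apply/imsetP; exists (p, l). Qed.

(** On at most [b / 2] points and [b / 2] lines there is room for only 1, 1, 4 incidences when [b]
    is 2, 3, 5. *)
Lemma thick_card_small : #|B| \notin [:: 2; 3; 5].
Proof.
have := pts_bound; have := lns_bound; have := card_product_bound.
move: #|B| #|pts| #|lns| => b x y; rewrite !inE => bxy yb xb.
by apply/negP => /or3P[]/eqP E; move: bxy; rewrite E in yb xb *; nia.
Qed.

(** With 4 incidences there are at most 2 lines, but a point on 2 lines requires a third. With 7
    there are at most 3 points, so one is on 3 lines and requires a fourth, while at most 3
    exist. *)
Lemma thick_card_quadrangle : no_quadrangle -> #|B| \notin [:: 4; 7].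
Proof.
move=> nq; have := lns_bound; have := pts_bound => xb yb.
apply/negP; rewrite !inE => /orP[]/eqP E.
  have [|p pp] := pts_gt0; first by rewrite E.
  have := quadrangle_bound nq pp; have := thick_row pp.
  by rewrite E in xb yb; clear -xb yb; lia.
have [|p pp] := @big_row 2; first by rewrite E in xb *; clear -xb; lia.
by have := quadrangle_bound nq pp; rewrite E in xb yb; clear -xb yb; lia.
Qed.

(** With 6 incidences there are at most 3 lines, but a point on 2 lines requires 4. With 9 there are
    at most 4 points, so one is on 3 lines and requires 6, while at most 4 exist. *)
Lemma thick_card_hexagon : no_quadrangle -> no_hexagon -> #|B| \notin [:: 6; 9].
Proof.
move=> nq nh; have := lns_bound; have := pts_bound => xb yb.
apply/negP; rewrite !inE => /orP[]/eqP E.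
  have [|p pp] := pts_gt0; first by rewrite E.
  have := hexagon_bound p nq nh; have := thick_row pp.
  by rewrite E in xb yb; clear -xb yb; lia.
have [|p pp] := @big_row 2; first by rewrite E in xb *; clear -xb; lia.
by have := hexagon_bound p nq nh; rewrite E in xb yb; clear -xb yb; lia.
Qed.

(** Here the counts are tight instead of contradictory: at most 5 lines leave exactly 2 at each
    point. *)
Lemma ten_rows : no_quadrangle -> no_hexagon -> #|B| = 10 ->
  #|pts| = 5 /\ forall p, p \in pts -> #|lines_at p| = 2.
Proof.
move=> nq nh E; have := lns_bound; have := pts_bound; rewrite E => xb yb.
have r2 p : p \in pts -> #|lines_at p| = 2.
  move=> pp; have := hexagon_bound p nq nh; have := thick_row pp; clear -yb; lia.
split=> //; have := card_rows; rewrite E (eq_bigr (fun=> 2)) // sum_nat_const; clear; lia.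
Qed.

End ThickFacts.

End Incidence.

Lemma ten_cols (X Y : finType) (B : {set X * Y}) :
  thick B -> no_quadrangle B -> no_hexagon B -> #|B| = 10 ->
  #|lns B| = 5 /\ forall l, l \in lns B -> #|points_at B l| = 2.
Proof.
move=> tB nq nh cB; pose B' := [set (q.2, q.1) | q in B].
have memB' l p : ((l, p) \in B') = ((p, l) \in B).
  by apply/imsetP/idP => [[[p' l'] pl [-> ->]] //|pl]; exists (p, l).
have rowE l : lines_at B' l = points_at B l by apply/setP => p; rewrite !inE memB'.
have colE p : points_at B' p = lines_at B p by apply/setP => l; rewrite !inE memB'.
have ptsE : pts B' = lns B.
  by apply/setP => l; apply/imsetP/imsetP => -[[x y] xy ->]; exists (y, x); rewrite ?memB' // -memB'.
rewrite -ptsE; have [||||-> H] := @ten_rows _ _ B'.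
- by move=> l p; rewrite memB' rowE colE => /tB[].
- by move=> l l' p p'; rewrite !memB' => h1 h2 h3 h4; case: (nq _ _ _ _ h1 h3 h2 h4) => ->; [right|left].
- move=> l1 l2 l3 p1 p2 p3; rewrite !memB' => h1 h2 h3 h4 h5 h6 n1 n2 n3.
  have [E|nE1] := eqVneq l1 l2; first by left.
  have [E|nE2] := eqVneq l2 l3; first by right; left.
  have [E|nE3] := eqVneq l3 l1; first by right; right.
  have := nh p2 p3 p1 l1 l2 l3 h2 h3 h4 h5 h6 h1 nE1 nE2 nE3.
  by case=> [|[|]] E; move: n1 n2 n3; rewrite E eqxx.
- by rewrite card_imset // => -[? ?] [? ?] [-> ->].
by split=> // l /H; rewrite rowE.
Qed.

Lemma set_inl_inr_inj (A B : finType) (p p' : A) (l l' : B) :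
  [set inl p; inr l] = [set inl p'; inr l'] :> {set A + B} -> p = p' /\ l = l'.
Proof.
move=> /setP E; have := E (inl p); have := E (inr l); rewrite !inE !eqxx orbT => El Ep.
split; first by case/esym/orP: Ep => /eqP // -[].
by case/esym/orP: El => /eqP // -[].
Qed.

Section Wenger.
Local Open Scope ring_scope.
Variables (F : finFieldType) (s : nat).

Local Notation wpoint := (F * {ffun 'I_s -> F})%type.

(** A point is its first coordinate [p.1] with the [s] others in [p.2]. The line [l] has direction
    [(1, t, ..., t^s)] for [t = l.1] and meets the hyperplane of first coordinate 0 at [l.2]. *)
Definition incident (p l : wpoint) : bool :=
  [forall j : 'I_s, p.2 j == l.2 j + p.1 * l.1 ^+ j.+1].

Lemma incidentP (p l : wpoint) : reflect (forall j : 'I_s, p.2 j = l.2 j + p.1 * l.1 ^+ j.+1) (incident p l).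
Proof. exact: 'forall_eqP. Qed.

Definition wenger : rel (wpoint + wpoint) := fun u v =>
  match u, v with
  | inl p, inr l => incident p l
  | inr l, inl p => incident p l
  | _, _ => false
  end.

Lemma wenger_sym : symmetric wenger.
Proof. by case=> [p|l] [p'|l']. Qed.

Lemma wenger_irr : irreflexive wenger.
Proof. by case. Qed.

Lemma incident_point_inj p p' l : incident p l -> incident p' l -> p.1 = p'.1 -> p = p'.
Proof.
case: p => [a w]; case: p' => [a' w'] /incidentP pl /incidentP pl' /= Ea.
by congr pair => //; apply/ffunP => j; have := pl j; have := pl' j; rewrite /= Ea => -> ->.
Qed.

Lemma incident_line_inj p l l' : incident p l -> incident p l' -> l.1 = l'.1 -> l = l'.
Proof.
case: l => [t u]; case: l' => [t' u'] /incidentP pl /incidentP pl' /= Et.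
congr pair => //; apply/ffunP => j; have := pl j; rewrite (pl' j) /= Et.
by move=> /addIr.
Qed.

Lemma wenger_card : (#|F| ^ s.+2 <= #|graph_edges wenger|)%N.
Proof.
pose f (x : F * wpoint) : {set wpoint + wpoint} :=
  [set inl (x.1, [ffun j => x.2.2 j + x.1 * x.2.1 ^+ j.+1] : {ffun 'I_s -> F}); inr x.2].
have inj : injective f.
  by move=> [a [t u]] [a' [t' u']] /set_inl_inr_inj[[-> _] [-> ->]].
have <- : #|[set: F * wpoint]| = (#|F| ^ s.+2)%N.
  by rewrite cardsT !card_prod card_ffun card_ord !expnS.
rewrite -(card_imset _ inj); apply: subset_leq_card; apply/subsetP => g /imsetP[[a [t u]] _ ->].
apply/imsetP; exists (inl (a, [ffun j => u j + a * t ^+ j.+1]), inr (t, u)) => //.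
by rewrite inE; apply/incidentP => j; rewrite ffunE.
Qed.

Section IncidenceSet.
Variable B : {set wpoint * wpoint}.
Hypothesis incB : forall p l, (p, l) \in B -> incident p l.

Lemma wenger_quadrangle : (0 < s)%N -> no_quadrangle B.
Proof.
move=> s0 p p' l l' /incB pl /incB pl' /incB p'l /incB p'l'.
pose j := Ordinal s0.
have : (p.1 - p'.1) * (l.1 - l'.1) = 0.
  have := incidentP _ _ pl j; have := incidentP _ _ p'l j.
  rewrite (incidentP _ _ pl' j) (incidentP _ _ p'l' j) /= !expr1 => E1 E2.
  have -> : (p.1 - p'.1) * (l.1 - l'.1) =
     (l.2 j + p.1 * l.1) - (l.2 j + p'.1 * l.1) - (p.1 * l'.1 - p'.1 * l'.1) by ring.
  by rewrite -E1 -E2; ring.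
move/eqP; rewrite mulf_eq0 !subr_eq0 => /orP[]/eqP E; [left|right].
  exact: (incident_point_inj pl p'l E).
exact: (incident_line_inj pl pl' E).
Qed.

Lemma wenger_hexagon : (1 < s)%N -> no_hexagon B.
Proof.
move=> s1 p1 p2 p3 l1 l2 l3 /incB i11 /incB i12 /incB i22 /incB i23 /incB i33 /incB i31 n12 n23 n31.
right; right; apply: (incident_point_inj i31 i11).
have nt p l l' : incident p l -> incident p l' -> l != l' -> l.1 - l'.1 != 0.
  by move=> pl pl'; rewrite subr_eq0; apply: contraNneq => /(incident_line_inj pl pl') ->.
have t12 := nt _ _ _ i11 i12 n12; have t31 := nt _ _ _ i33 i31 n31.
(* The displacements around the hexagon add up to 0. The coefficients themselves also have sum 0, so
   two values of [j] complete a Vandermonde system of size 3. *)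
have rel (j : 'I_s) : (p1.1 - p3.1) * l1.1 ^+ j.+1 + (p2.1 - p1.1) * l2.1 ^+ j.+1
    + (p3.1 - p2.1) * l3.1 ^+ j.+1 = 0.
  have e1 := incidentP _ _ i11 j; have e2 := incidentP _ _ i12 j.
  have e3 := incidentP _ _ i22 j; have e4 := incidentP _ _ i23 j.
  have e5 := incidentP _ _ i33 j; have e6 := incidentP _ _ i31 j.
  rewrite !mulrBl.
  have -> : forall x y z x' y' z' : F, x - y + (z - x') + (y' - z') =
    (l1.2 j + x) - (l1.2 j + y) + ((l2.2 j + z) - (l2.2 j + x')) + ((l3.2 j + y') - (l3.2 j + z')).
    by move=> *; ring.
  by rewrite -e1 -e2 -e3 -e4 -e5 -e6; ring.
have r1 := rel (Ordinal (ltnW s1)); have r2 := rel (Ordinal s1).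
rewrite /= in r2; rewrite /= !expr1 in r1.
(* Up to sign, the relations are combined with the coefficients of [(X - l2.1) (X - l3.1)], which
   kills the second and third terms. *)
have : (p1.1 - p3.1) * ((l1.1 - l2.1) * (l3.1 - l1.1)) = 0.
  have -> : (p1.1 - p3.1) * ((l1.1 - l2.1) * (l3.1 - l1.1)) =
    (l2.1 + l3.1) * ((p1.1 - p3.1) * l1.1 + (p2.1 - p1.1) * l2.1 + (p3.1 - p2.1) * l3.1) -
    ((p1.1 - p3.1) * l1.1 ^+ 2 + (p2.1 - p1.1) * l2.1 ^+ 2 + (p3.1 - p2.1) * l3.1 ^+ 2).
    by ring.
  by rewrite r1 r2 mulr0 subr0.
move/eqP; rewrite !mulf_eq0 (negbTE t12) (negbTE t31) !orbF subr_eq0.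
by move/eqP.
Qed.

(* A direction used by exactly one line gives a polynomial in the direction vanishing at all
   the others; the associated affine form is constant along all lines but one.  The number of
   incidences at a fixed value of the form is then even when counted by points, odd by lines. *)
Lemma wenger_no_ten : s = 4%N -> thick B -> #|B| != 10%N.
Proof.
move=> s4 tB; apply/eqP => cB.
have nq : no_quadrangle B by apply: wenger_quadrangle; rewrite s4.
have nh : no_hexagon B by apply: wenger_hexagon; rewrite s4.
have [cP rows] := ten_rows tB nq nh cB; have [cL cols] := ten_cols tB nq nh cB.
pose dir (t : F) : {set wpoint} := [set l in lns B | l.1 == t].
(* Lines of one direction are disjoint, and three of them would need 6 points out of 5. *)
have dir_le2 t : (#|dir t| <= 2)%N.
  rewrite leqNgt; apply/negP => /card_gt2P[l1 [l2 [l3 [[h1 h2 h3] [n12 n23 n31]]]]].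
  have disj l l' : l \in dir t -> l' \in dir t -> l != l' -> [disjoint points_at B l & points_at B l'].
    rewrite !inE => /andP[_ /eqP Et] /andP[_ /eqP Et'] /eqP ne.
    rewrite -setI_eq0; apply/set0Pn => -[p]; rewrite !inE => /andP[/incB pl /incB pl'].
    by apply: ne; apply: incident_line_inj pl pl' _; rewrite Et Et'.
  have c2 l : l \in dir t -> #|points_at B l| = 2%N by rewrite inE => /andP[/cols].
  have : (#|points_at B l1 :|: points_at B l2 :|: points_at B l3| <= #|pts B|)%N.
    by apply: subset_leq_card; rewrite !subUset !col_pts.
  have d12 := disj _ _ h1 h2 n12; have d23 := disj _ _ h2 h3 n23; have d31 := disj _ _ h3 h1 n31.
  have cardU (A C : {set wpoint}) : [disjoint A & C] -> #|A :|: C| = (#|A| + #|C|)%N.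
    by move=> d; rewrite cardsU disjoint_setI0 // cards0 subn0.
  rewrite cardU; last first.
    by rewrite -setI_eq0 setIUl setU_eq0 !setI_eq0 d23 andbT disjoint_sym.
  by rewrite cardU // !c2 // cP.
have sum_dir : (\sum_(t : F) #|dir t| = 5)%N.
  rewrite -cL -sum1_card (partition_big (fun l => l.1) xpredT) //=.
  by apply: eq_bigr => t _; rewrite -sum1_card; apply: eq_bigl => l; rewrite inE.
(* Five is odd and no class exceeds 2, so some class is a singleton. *)
have [t /cards1P[l0 dl0]] : exists t, #|dir t| == 1%N.
  apply/existsP; apply: contraPT sum_dir => /existsPn none.
  have : ~~ odd (\sum_(t : F) #|dir t|).
    elim/big_ind: _ => // [m n|t _]; first by rewrite oddD => /negbTE-> /negbTE->.
    by move: (none t) (dir_le2 t); case: (#|dir t|) => [|[|[|]]].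
  by move=> + E; rewrite E.
have l0t : l0 \in dir t by rewrite dl0 inE.
have [l0L l0d] : l0 \in lns B /\ l0.1 = t by move: l0t; rewrite inE => /andP[? /eqP].
pose T := [set l.1 | l in lns B] :\ t.
(* At most 4 directions besides [t] occur, so [g] has at most [s + 1 = 5] coefficients, as many as a
   point has coordinates. This is where [s = 4] enters. *)
pose g : {poly F} := \prod_(z <- enum T) ('X - z%:P).
have sg : (size g <= s.+1)%N.
  rewrite /g size_prod_XsubC -cardE ltnS s4 -ltnS.
  have tT : t \in [set l.1 | l in lns B] by apply/imsetP; exists l0.
  have := leq_imset_card (fun l : wpoint => l.1) (mem (lns B)).
  by rewrite (cardsD1 t) tT cL.
have gz l : l \in lns B -> l != l0 -> g.[l.1] = 0.
  move=> lL ne; apply/eqP; rewrite -/(root g l.1) root_prod_XsubC mem_enum !inE.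
  apply/andP; split; last by apply/imsetP; exists l.
  apply: contra ne => /eqP lt; have : l \in dir t by rewrite inE lL lt eqxx.
  by rewrite dl0 inE.
have gt0 : g.[t] != 0 by rewrite -/(root g t) root_prod_XsubC mem_enum !inE eqxx.
(* Along a line [l] this is [p.1 * g.[l.1]] plus a constant, so among the lines of [B] it varies
   only on [l0]. *)
pose f (p : wpoint) : F := g`_0 * p.1 + \sum_(j < s) g`_j.+1 * p.2 j.
have fE p l : incident p l -> f p = p.1 * g.[l.1] + \sum_(j < s) g`_j.+1 * l.2 j.
  move=> /incidentP pl; rewrite (horner_coef_wide _ sg) big_ord_recl expr0 mulr1 mulrDr mulr_sumr.
  rewrite /f mulrC -addrA; congr (_ + _); rewrite -big_split; apply: eq_bigr => j _ /=.
  by rewrite (pl j) /bump /=; ring.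
have : #|points_at B l0| == 2%N by rewrite cols.
case/cards2P => p [p' [pp' colE]].
have pl0 : (p, l0) \in B by have := set21 p p'; rewrite -colE inE.
have p'l0 : (p', l0) \in B by have := set22 p p'; rewrite -colE inE.
have fne : f p' != f p.
  rewrite (fE _ _ (incB pl0)) (fE _ _ (incB p'l0)) -subr_eq0 opprD addrACA subrr addr0.
  rewrite -mulrBl l0d mulf_neq0 // subr_eq0; apply: contraNneq pp' => E.
  by rewrite (incident_point_inj (incB p'l0) (incB pl0) E).
pose Z := [set q in B | f q.1 == f p].
have rowZ q : q \in pts Z -> lines_at Z q = lines_at B q.
  case/imsetP => -[q' l] qZ /= ->; move: qZ; rewrite inE /= => /andP[_ fq].
  by apply/setP => l'; rewrite !inE /= fq andbT.
have evenP : ~~ odd #|Z|.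
  rewrite card_rows; elim/big_ind: _ => // [m n|q qZ].
    by rewrite oddD => /negbTE-> /negbTE->.
  rewrite rowZ // rows //; case/imsetP: qZ => -[q' l] + -> /=.
  by rewrite inE => /andP[qB _]; apply/imsetP; exists (q', l).
have l0Z : l0 \in lns Z by apply/imsetP; exists (p, l0); rewrite // inE pl0 eqxx.
have colZ l : l \in lns Z -> l != l0 -> points_at Z l = points_at B l.
  case/imsetP => -[q l'] qZ /= -> ne; move: qZ; rewrite inE /= => /andP[qB /eqP fq].
  have lL : l' \in lns B by apply/imsetP; exists (q, l').
  apply/setP => q'; rewrite !inE /=; case q'B: ((q', l') \in B) => //=.
  by rewrite -fq (fE _ _ (incB qB)) (fE _ _ (incB q'B)) !gz // !mulr0 eqxx.
have colZ0 : points_at Z l0 = [set p].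
  apply/setP => q; rewrite !inE /=; apply/andP/eqP => [[qB fq]|->]; last by rewrite pl0 eqxx.
  have : q \in points_at B l0 by rewrite inE.
  rewrite colE !inE => /orP[]/eqP // Eq.
  by move: fq; rewrite Eq (negbTE fne).
case/negP: evenP; rewrite card_cols (bigD1 l0) //= colZ0 cards1 oddD addTb.
elim/big_ind: _ => // [m n|l /andP[lZ ne]].
  by rewrite oddD => /negbTE-> /negbTE->.
rewrite colZ // cols //; case/imsetP: lZ => -[q l'] + -> /=.
by rewrite inE => /andP[qB _]; apply/imsetP; exists (q, l').
Qed.

End IncidenceSet.

(** Here [s = r - 1]. For [s = 0] incidence is an empty condition and the graph is complete
    bipartite. *)
Definition wenger_free (s m : nat) : bool :=
  (s, m) \in [:: (0, 2); (0, 3); (0, 5); (1, 4); (1, 7); (2, 6); (2, 9); (4, 10)]%N.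

Lemma wenger_leafless (S : {set {set wpoint + wpoint}}) (m : nat) :
  wenger_free s m -> leafless wenger S -> #|S| != m.
Proof.
move=> sm [S1 S2].
pose B := [set q : wpoint * wpoint | [set inl q.1; inr q.2] \in S].
have pairE := @set_inl_inr_inj wpoint wpoint.
have SE f : f \in S -> exists p l, [/\ f = [set inl p; inr l], (p, l) \in B & incident p l].
  move=> fS; have [u [v [uv Ef]]] := S1 f fS; case: u v uv Ef => [p|l] [p'|l'] //= pl Ef.
    by exists p, l'; rewrite inE -Ef.
  by exists p', l; rewrite inE setUC -Ef.
have cB : #|S| = #|B|.
  have inj : injective (fun q : wpoint * wpoint => [set inl q.1; inr q.2] : {set wpoint + wpoint}).
    by move=> [p l] [p' l'] /pairE[/= -> ->].
  rewrite -(card_imset (mem B) inj); apply: eq_card => f; apply/idP/imsetP.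
    by move=> /SE[p [l [-> pB _]]]; exists (p, l).
  by case=> -[p l]; rewrite inE => pB ->.
have incB p l : (p, l) \in B -> incident p l.
  by rewrite inE /= => /SE[p' [l' [/pairE[-> ->]]]].
have tB : thick B.
  move=> p l; rewrite inE /= => plS.
  have [f1 [f1S ne1 pf1]] := S2 _ (inl p) plS (set21 _ _).
  have [f2 [f2S ne2 lf2]] := S2 _ (inr l) plS (set22 _ _).
  have [p1 [l1 [E1 B1 _]]] := SE _ f1S; have [p2 [l2 [E2 B2 _]]] := SE _ f2S.
  move: pf1 lf2; rewrite E1 E2 !inE => /orP[]/eqP // [Ep] /orP[]/eqP // [El].
  split; apply/card_gt1P.
    exists l, l1; split; [by rewrite !inE|by rewrite inE Ep|].
    by apply: contraNneq ne1 => ->; rewrite E1 Ep.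
  exists p, p2; split; [by rewrite !inE|by rewrite inE El|].
  by apply: contraNneq ne2 => ->; rewrite E2 El.
rewrite cB; move: sm; rewrite /wenger_free !inE !xpair_eqE.
have small := thick_card_small tB; rewrite !inE !negb_or in small.
have nq := wenger_quadrangle incB; have nh := wenger_hexagon incB.
have quad s0 := thick_card_quadrangle tB (nq s0).
have hex s0 s1 := thick_card_hexagon tB (nq s0) (nh s1).
case/andP: small => n2 /andP[n3 n5].
case/orP => [/andP[_ /eqP-> //]|]; case/orP => [/andP[_ /eqP-> //]|].
case/orP => [/andP[_ /eqP-> //]|].
case/orP => [/andP[/eqP s1 /eqP->]|].
  have /quad : (0 < s)%N by rewrite s1.
  by rewrite !inE negb_or => /andP[].
case/orP => [/andP[/eqP s1 /eqP->]|].
  have /quad : (0 < s)%N by rewrite s1.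
  by rewrite !inE negb_or => /andP[].
case/orP => [/andP[/eqP s1 /eqP->]|].
  have s0 : (0 < s)%N by rewrite s1.
  have /(hex s0) : (1 < s)%N by rewrite s1.
  by rewrite !inE negb_or => /andP[].
case/orP => [/andP[/eqP s1 /eqP->]|].
  have s0 : (0 < s)%N by rewrite s1.
  have /(hex s0) : (1 < s)%N by rewrite s1.
  by rewrite !inE negb_or => /andP[].
by case/andP => /eqP s4 /eqP->; apply: wenger_no_ten.
Qed.

End Wenger.

(* There are 4 q^(s+1) colours, and q^(s+2) <= 2^(s+2) n for the least sufficient power q of 2. *)
Definition wenger_const (s : nat) : nat := 4 ^ s.+2 * (2 ^ s.+2) ^ s.+1.

Lemma sparse_trail_coloring (s m n : nat) : wenger_free s m -> 0 < n ->
  exists (V : finType) (e : rel V) (c : nat -> V + V),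
    [/\ symmetric e, irreflexive e, (forall S, leafless e S -> #|S| != m),
        trail_coloring e n c & (2 * #|V|) ^ s.+2 <= wenger_const s * n ^ s.+1].
Proof.
move=> sm n0.
(* The exponent must be positive for [2 ^ k] to be the order of a field; its minimality loses at
   most one doubling of [q]. *)
have [k [k0 nk kn]] : exists k, [/\ 0 < k, n <= (2 ^ k) ^ s.+2 & (2 ^ k) ^ s.+2 <= 2 ^ s.+2 * n].
  have ex : exists k, n <= (2 ^ k.+1) ^ s.+2.
    exists n; apply: ltnW; apply: (@leq_trans (2 ^ n.+1)).
      by apply: ltn_trans (ltnSn n) _; apply: ltn_expl.
    by rewrite -[leqLHS]expn1 leq_pexp2l // expn_gt0.
  case: (ex_minnP ex) => k nk kmin; exists k.+1; split=> //.
  case: k nk kmin => [|k] nk kmin; first by rewrite expn1 leq_pmulr.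
  rewrite (expnS 2 k.+1) expnMn leq_mul2l expn_eq0 /=; apply: ltnW; rewrite ltnNge.
  by apply/negP => /kmin; rewrite ltnn.
have [F _ cF] := PrimePowerField (isT : prime 2) k0.
pose V : finType := ((F * {ffun 'I_s -> F}) + (F * {ffun 'I_s -> F}))%type.
pose e : rel V := @wenger F s.
have [|c cP] := @exists_trail_coloring V e (@wenger_irr F s) n n0.
  by apply: leq_trans (wenger_card F s); rewrite cF.
exists V, e, c; split=> //.
- exact: wenger_sym.
- exact: wenger_irr.
- by move=> S lS; apply: wenger_leafless sm lS.
have -> : #|V| = 2 * (2 ^ k) ^ s.+1.
  by rewrite card_sum card_prod card_ffun card_ord cF expnS addnn mul2n.
rewrite /wenger_const mulnA (expnMn (2 * 2)) -mulnA leq_mul2l; apply/orP; right.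
by rewrite expnAC -expnMn leq_exp2r.
Qed.

(** * Pairing up a set with even gaps *)

Section EvenGaps.
Variables (n m : nat) (S : {set 'I_n}).
Hypothesis cardS : #|S| = 2 * m.
Hypothesis even_gap : forall j, j \notin S -> ~~ odd #|[set i in S | i < j]|.

Let rank (k : nat) : nat := #|[set i in S | i < k]|.

Lemma rankS (x : 'I_n) : rank x.+1 = (x \in S) + rank x.
Proof.
rewrite /rank (cardsD1 x) inE ltnSn andbT; congr (_ + _); apply: eq_card => i.
by rewrite !inE -val_eqE ltnS (ltn_neqAle i x) andbCA.
Qed.

Let L : {set 'I_n} := [set x in S | ~~ odd (rank x)].

(** [L] collects the left members of the pairs. Just after [x] the rank is odd, so the next position
    cannot be a gap, and it exists because [S] has even size. *)
Lemma left_next x : x \in L -> exists2 y, y \in S :\: L & y = x.+1 :> nat.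
Proof.
rewrite inE => /andP[xS ev].
have od : odd (rank x.+1) by rewrite rankS xS -[nat_of_bool true]/1 add1n /= ev.
have xn : x.+1 < n.
  rewrite ltn_neqAle ltn_ord andbT; apply: contraTneq od => ->.
  have -> : rank n = #|S| by apply: eq_card => i; rewrite inE ltn_ord andbT.
  by rewrite cardS mul2n odd_double.
exists (Ordinal xn) => //; rewrite !inE /= od andbF /=.
by apply: contraLR od => /even_gap.
Qed.

Lemma right_prev y : y \in S :\: L -> exists2 x, x \in L & y = x.+1 :> nat.
Proof.
rewrite !inE negb_and negbK => /andP[/orP[nyS|od] yS]; first by rewrite yS in nyS.
case: y od yS => [[|x] xn] od yS.
  have : 0 < rank 0 by rewrite lt0n; apply: contraTneq od => /= ->.
  by case/card_gt0P => i; rewrite inE ltn0 andbF.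
pose x' := Ordinal (ltnW xn); exists x' => //.
have := rankS x'; rewrite /= in od *.
rewrite inE; have [xS E|/even_gap ev E] := boolP (x' \in S).
  by move: od; rewrite E -[nat_of_bool true]/1 add1n.
by move: od; rewrite E add0n (negbTE ev).
Qed.

Lemma even_gap_pairs : exists L' : {set 'I_n}, [/\ #|L'| = m,
  (forall l, l \in L' -> l \in S /\ exists2 y, y \in S & y = l.+1 :> nat) &
  (forall y, y \in S -> exists2 l, l \in L' & y = l :> nat \/ y = l.+1 :> nat)].
Proof.
exists L; split.
- have LS : L \subset S by apply/subsetP => x; rewrite inE => /andP[].
  have nextP x : exists y, x \in L -> y \in S :\: L /\ y = x.+1 :> nat.
    have [/left_next[y yS E]|] := boolP (x \in L); last by exists x.
    by exists y.
  have [f fP] := fin_all_exists nextP.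
  have finj : {in L &, injective f}.
    move=> x x' /fP[_ E] /fP[_ E'] Ef; apply/val_inj/eqP.
    by rewrite -eqSS -E -E' Ef.
  have : #|S :\: L| = #|L|.
    rewrite -(card_in_imset finj); apply: eq_card => y; apply/idP/imsetP.
      move=> yS; have [x xL E] := right_prev yS; exists x => //.
      by have [_ E'] := fP x xL; apply: val_inj; rewrite /= E E'.
    by case=> x xL ->; have [] := fP x xL.
  move=> EC; have := cardsID L S; rewrite (setIidPr LS) cardS EC addnn -mul2n => /eqP.
  by rewrite eqn_pmul2l // => /eqP.
- move=> l lL; split; first by move: lL; rewrite inE => /andP[].
  by have [y yS E] := left_next lL; exists y => //; move: yS; rewrite inE => /andP[].
- move=> y yS; have [yL|yL] := boolP (y \in L); first by exists y; [|left].
  have [|x xL E] := @right_prev y; first by rewrite in_setD yL.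
  by exists x; [|right].
Qed.

End EvenGaps.

(** A separator in [S] is unique. Otherwise [S] avoids position 0, the evenness condition applies
    and splits [S] into [m] trail edges; if every colour recurred, these would be leafless of the
    forbidden size. *)
Lemma trail_coloring_conflict_free (V : finType) (e : rel V) (n m : nat) (c : nat -> V + V)
    (S : {set 'I_n}) :
  symmetric e -> irreflexive e -> (forall S', leafless e S' -> #|S'| != m) ->
  trail_coloring e n c -> 0 < m -> #|S| = 2 * m ->
  ((forall i, i \in S -> 0 < i) -> forall j, j \notin S -> ~~ odd #|[set i in S | i < j]|) ->
  exists2 x, x \in S & forall y, y \in S -> y != x -> c y != c x.
Proof.
move=> esym eirr free [[x0 c0] csep cedge cinj] m0 cS gale.
have [/exists_inP[x xS] | /exists_inPn noninr] :=
    boolP [exists x in S, if c x is inr _ then true else false].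
  case E: (c x) => [//|z] _; exists x => // y yS; rewrite E; apply: contraNneq => E'.
  exact/eqP/val_inj/(csep y x z (ltn_ord y) (ltn_ord x) E' E).
pose vx (i : nat) : V := if c i is inl v then v else x0.
have vxE i : i \in S -> c i = inl (vx i).
  by move=> /noninr; rewrite /vx; case: (c i).
have [|L [cL Lnext SL]] := even_gap_pairs cS.
  apply: gale => i iS; rewrite lt0n; apply/eqP => i0.
  by have := noninr _ iS; rewrite i0 c0.
pose edge (l : nat) : {set V} := [set vx l; vx l.+1].
have Ledge l : l \in L -> [/\ l.+1 < n, c l = inl (vx l), c l.+1 = inl (vx l.+1) & e (vx l) (vx l.+1)].
  move=> /Lnext[lS [y yS Ey]].
  have ln : l.+1 < n by rewrite -Ey.
  have El := vxE l lS; have Ey' := vxE y yS; rewrite Ey in Ey'; split=> //.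
  by have := cedge l _ _ ln El Ey'; rewrite esym orbb.
have einj : {in L &, injective (fun l : 'I_n => edge l)}.
  move=> l l' /Ledge[ln cl cl' _] /Ledge[l'n cl1 cl1' _] E.
  by apply: val_inj; apply: cinj cl cl' cl1 cl1' E.
have [/exists_inP[x xS /forall_inP H]|/exists_inPn conf] :=
    boolP [exists x in S, [forall y in S, (y != x) ==> (c y != c x)]].
  by exists x => // y yS; apply/implyP/H.
have confP x : x \in S -> exists y, [/\ y \in S, y != x & vx y = vx x].
  move=> xS; have := conf x xS.
  case/forall_inPn => y yS; rewrite negb_imply negbK => /andP[yx]; rewrite (vxE _ yS) (vxE _ xS) => /eqP[E].
  by exists y.
have lS : leafless e [set edge l | l : 'I_n in L].
  split=> [f /imsetP[l lL ->]|f v /imsetP[l lL ->]].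
    by have [_ _ _ el] := Ledge l lL; exists (vx l), (vx l.+1).
  have [ln cl cl' el] := Ledge l lL; have [lS [l1 l1S El1]] := Lnext l lL.
  have key x : x \in S -> x = l :> nat \/ x = l.+1 :> nat ->
      exists f', [/\ f' \in [set edge l | l : 'I_n in L], f' != edge l & vx x \in f'].
    move=> xS xl; have [y [yS yx Ev]] := confP x xS; have [l' l'L yl'] := SL y yS.
    exists (edge l'); split; first exact: imset_f.
      (* If the two edges agreed, [x] and [y] would be the two ends of one edge and carry one
         colour, making it a loop. *)
      apply: contraTneq el => /(einj _ _ l'L lL) El'; rewrite El' in yl'.
      suff -> : vx l = vx l.+1 by rewrite eirr.
      move: Ev yx; rewrite -val_eqE /=.
      case: yl' => ->; case: xl => ->; rewrite ?eqxx // => ->.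
    by rewrite -Ev; case: yl' => ->; [exact: set21|exact: set22].
  case/set2P => ->; [apply: (key l) => //; by left|].
  by rewrite -El1; apply: key => //; right.
by have := free _ lS; rewrite card_in_imset // cL eqxx.
Qed.

(** * Facets of cyclic polytopes *)

From mathcomp Require Import all_classical all_reals all_analysis.
From mathcomp Require Import lra.
Import Order.TTheory GRing.Theory Num.Theory.
Import numFieldNormedType.Exports.
Local Open Scope classical_set_scope.
Local Open Scope ring_scope.

Section CyclicPolytope.
Variables (R : realType) (d n : nat).
Implicit Types (g h : {poly R}) (x y : 'rV[R]_d) (Z : {set 'I_n}).
Local Notation curve := (@cyclic_point R d n).
Local Notation P := (@cyclic_polytope R d n).
Local Notation node i := (i.+1%:R : R).

Lemma dotmul_sum (a : 'rV[R]_d) (I : finType) (w : I -> R) (f : I -> 'rV[R]_d) :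
  dotmul a (\sum_i w i *: f i) = \sum_i w i * dotmul a (f i).
Proof.
rewrite /dotmul (eq_bigr (fun j => \sum_i w i * (a 0 j * f i 0 j))).
  by rewrite exchange_big; apply: eq_bigr => i _; rewrite mulr_sumr.
move=> j _; rewrite summxE mulr_sumr; apply: eq_bigr => i _.
by rewrite mxE mulrCA.
Qed.

Lemma dotmulB (a x y : 'rV[R]_d) : dotmul a (x - y) = dotmul a x - dotmul a y.
Proof.
by rewrite /dotmul -sumrB; apply: eq_bigr => j _; rewrite !mxE mulrBr.
Qed.

(* The affine form on R^d whose pullback to the moment curve is the polynomial g. *)
Definition polyform g x : R := g`_0 + dotmul (\row_j g`_j.+1) x.

Lemma polyform_curve g i : (size g <= d.+1)%N -> polyform g (curve i) = g.[node i].
Proof.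
move=> sg; rewrite (horner_coef_wide _ sg) big_ord_recl expr0 mulr1 /polyform /dotmul.
by congr (_ + _); apply: eq_bigr => j _; rewrite !mxE.
Qed.

Lemma polyform_combo g (w : 'I_n -> R) : (size g <= d.+1)%N -> \sum_i w i = 1 ->
  polyform g (\sum_i w i *: curve i) = \sum_i w i * g.[node i].
Proof.
move=> sg w1; rewrite /polyform dotmul_sum.
have -> : g`_0 = \sum_i w i * g`_0 by rewrite -mulr_suml w1 mul1r.
rewrite -big_split /=.
by apply: eq_bigr => i _; rewrite -(polyform_curve _ sg) /polyform mulrDr.
Qed.

(** The hyperplane [dotmul a x = b] becomes the polynomial with constant coefficient [b] and the
    other coefficients taken from [- a]. *)
Lemma face_polyform (A F : set 'rV[R]_d) : is_face A F <->
  exists g, [/\ (size g <= d.+1)%N, forall x, A x -> 0 <= polyform g x &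
                F = A `&` [set x | polyform g x = 0]].
Proof.
split=> [[a [b [ab ->]]]|[g [sg g0 ->]]].
  pose g := b%:P - \sum_(j < d) a 0 j *: 'X^(j.+1).
  have gb : g`_0 = b.
    rewrite coefB coefC eqxx coef_sum big1 ?subr0 // => j _.
    by rewrite coefZ coefXn mulr0.
  have ga (j : 'I_d) : g`_j.+1 = - a 0 j.
    rewrite coefB coefC /= sub0r coef_sum (bigD1 j) //= big1 => [|k kj].
      by rewrite coefZ coefXn eqxx mulr1 addr0.
    by rewrite coefZ coefXn eqSS eq_sym val_eqE (negbTE kj) mulr0.
  have gE x : polyform g x = b - dotmul a x.
    rewrite /polyform gb /dotmul -sumrN; congr (_ + _); apply: eq_bigr => j _.
    by rewrite mxE ga mulNr.
  exists g; split.
  - rewrite (leq_trans (size_polyD _ _)) // geq_max size_polyN (leq_trans (size_polyC_leq1 _)) //=.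
    rewrite (leq_trans (size_sum _ _ _)) //; apply/bigmax_leqP => j _.
    by rewrite (leq_trans (size_scale_leq _ _)) // size_polyXn ltnS.
  - by move=> x /ab; rewrite gE subr_ge0.
  - congr (_ `&` _); apply/funext => x; rewrite /= gE; apply/propext.
    by split=> [->|/eqP]; [rewrite subrr|rewrite subr_eq0 => /eqP].
exists (- \row_j g`_j.+1), (g`_0).
have E x : polyform g x = g`_0 - dotmul (- \row_j g`_j.+1) x.
  rewrite /polyform /dotmul -sumrN; congr (_ + _); apply: eq_bigr => j _.
  by rewrite !mxE mulNr opprK.
split=> [x /g0|]; first by rewrite E subr_ge0.
congr (_ `&` _); apply/funext => x; rewrite /= E; apply/propext.
by split=> [/eqP|->]; [rewrite subr_eq0 => /eqP|rewrite subrr].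
Qed.

Definition is_combo Z x : Prop := exists w : 'I_n -> R,
  [/\ (forall i, 0 <= w i), (forall i, i \notin Z -> w i = 0),
      \sum_i w i = 1 & x = \sum_i w i *: curve i].

Lemma hull_combo x : P x -> is_combo [set: 'I_n]%SET x.
Proof.
apply: (@smallest_sub _ _ _ (is_combo [set: 'I_n]%SET)) => [y z l|y [i _ <-]].
  rewrite !inE => -[w [w0 _ w1 ->]] [v [v0 _ v1 ->]].
  have l0 : 0 <= l%:num by [].
  have l1 : 0 <= 1 - l%:num by rewrite subr_ge0.
  exists (fun i => l%:num * w i + (1 - l%:num) * v i); split.
  - by move=> i; rewrite addr_ge0 // mulr_ge0.
  - by move=> i; rewrite inE.
  - by rewrite big_split /= -!mulr_sumr w1 v1 !mulr1 addrC subrK.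
  - rewrite -[LHS]/(l%:num *: _ + (1 - l%:num) *: _) !scaler_sumr -big_split.
    by apply: eq_bigr => i _; rewrite [RHS]scalerDl !scalerA.
exists (fun j => (j == i)%:R); split.
- by move=> j; rewrite ler0n.
- by move=> j; rewrite inE.
- by rewrite (bigD1 i) //= eqxx big1 ?addr0 // => j /negbTE->.
- by rewrite (bigD1 i) //= eqxx scale1r big1 ?addr0 // => j /negbTE->; rewrite scale0r.
Qed.

Lemma hull_curve i : P (curve i).
Proof. by apply: sub_gen_smallest; exists i. Qed.

Lemma hull_polyform_ge0 g x : (size g <= d.+1)%N -> (forall i : 'I_n, 0 <= g.[node i]) ->
  P x -> 0 <= polyform g x.
Proof.
move=> sg g0 /hull_combo[w [w0 _ w1 ->]]; rewrite polyform_combo //.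
by apply: sumr_ge0 => i _; apply: mulr_ge0.
Qed.

Definition zeros g : {set 'I_n} := [set i : 'I_n | g.[node i] == 0]%SET.

Definition poly_face g : set 'rV[R]_d := P `&` [set x | polyform g x = 0].

Lemma poly_face_curve g i : (size g <= d.+1)%N -> poly_face g (curve i) <-> i \in zeros g.
Proof.
move=> sg; rewrite inE -polyform_curve //; split=> [[_ /eqP]|/eqP] //.
by split=> //; apply: hull_curve.
Qed.

Lemma sum_mul_eq0 (w v : 'I_n -> R) : (forall i, 0 <= w i) -> (forall i, w i != 0 -> 0 <= v i) ->
  \sum_i w i * v i = 0 -> forall i, w i != 0 -> v i = 0.
Proof.
move=> w0 v0 /eqP; rewrite psumr_eq0 => [/allP H i wi|i _]; last first.
  by have [->|wi] := eqVneq (w i) 0; rewrite ?mul0r // mulr_ge0 // v0.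
by have := H i (mem_index_enum i); rewrite /= mulf_eq0 (negbTE wi) => /eqP.
Qed.

Lemma poly_face_combo g x : (size g <= d.+1)%N -> (forall i : 'I_n, 0 <= g.[node i]) ->
  poly_face g x -> is_combo (zeros g) x.
Proof.
move=> sg g0 [/hull_combo[w [w0 _ w1 ->]] /=]; rewrite polyform_combo // => E.
exists w; split=> // i; rewrite inE => gi; apply/eqP/negPn/negP => wi.
by case/negP: gi; apply/eqP; apply: sum_mul_eq0 E _ wi.
Qed.

Lemma curve_inj : (0 < d)%N -> injective curve.
Proof.
move=> d0 i j /rowP/(_ (Ordinal d0)); rewrite !mxE !expr1 => /eqP.
by rewrite eqr_nat eqSS => /eqP/val_inj.
Qed.

Lemma combo_pos Z x : is_combo Z x -> exists w : 'I_n -> R, exists2 i, i \in Z & 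
  [/\ 0 < w i, (forall i, 0 <= w i), (forall i, i \notin Z -> w i = 0),
      \sum_i w i = 1 & x = \sum_i w i *: curve i].
Proof.
move=> [w [w0 wZ w1 xE]]; exists w.
have [i wi] : exists i, w i != 0.
  apply: contrapT => H; have := oner_eq0 R; rewrite -w1 big1 ?eqxx // => i _.
  by apply/eqP/negPn/negP => wi; apply: H; exists i.
exists i; last by split=> //; rewrite lt0r wi w0.
by apply: contraNT wi => /wZ ->.
Qed.

(** A single curve point is cut out by a squared linear factor, whose degree 2 requires [1 < d].
    Conversely, a form cutting out [v] vanishes at each curve point of positive weight in [v], so
    that point is [v]. *)
Lemma vertices_poly_face g : (1 < d)%N -> (size g <= d.+1)%N ->
  (forall i : 'I_n, 0 <= g.[node i]) -> vertices (poly_face g) = curve @` [set i | i \in zeros g].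
Proof.
move=> d1 sg g0; apply/seteqP; split=> [v /face_polyform[h [sh h0 E]]|_ [z /= zZ <-]].
  have [vF hv] : poly_face g v /\ polyform h v = 0.
    by have : [set v] v by []; rewrite E => -[].
  have [w [z zZ [wz w0 wZ w1 vE]]] := combo_pos (poly_face_combo sg g0 vF).
  exists z => //; suff : [set v] (curve z) by [].
  rewrite E; split; first exact/poly_face_curve.
  rewrite /= polyform_curve //.
  move: hv; rewrite vE polyform_combo // => hv; apply: (sum_mul_eq0 w0 _ hv); last first.
    by rewrite gt_eqF.
  move=> i wi; rewrite -polyform_curve //; apply/h0/poly_face_curve => //.
  by apply: contraNT wi => /wZ ->.
apply/face_polyform; pose h : {poly R} := ('X - (node z)%:P) ^+ 2.
have sh : (size h <= d.+1)%N by rewrite size_exp_XsubC ltnS.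
have hE i : h.[node i] = (node i - node z) ^+ 2 by rewrite !hornerE.
have h0 i : 0 <= h.[node i] by rewrite hE sqr_ge0.
exists h; split=> //; first by move=> x [/hull_polyform_ge0 H _]; apply: H.
apply/seteqP; split=> [_ ->|x [/(poly_face_combo sg g0)[w [w0 wZ w1 xE]]]].
  split; first exact/poly_face_curve.
  by rewrite /= polyform_curve // hE subrr expr0n.
rewrite /= xE polyform_combo // => hx.
have wz i : i != z -> w i = 0.
  move=> iz; apply/eqP/negPn/negP => wi.
  have := sum_mul_eq0 w0 (fun i _ => h0 i) hx wi; rewrite hE => /eqP.
  by rewrite sqrf_eq0 subr_eq0 eqr_nat eqSS val_eqE (negbTE iz).
have w1z : w z = 1 by rewrite -w1 (bigD1 z) //= big1 ?addr0 // => i /wz.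
by rewrite (bigD1 z) //= w1z scale1r big1 ?addr0 // => i /wz ->; rewrite scale0r.
Qed.

Definition nodes_poly Z : {poly R} := \prod_(z <- enum Z) ('X - (node z)%:P).

Lemma size_nodes_poly Z : size (nodes_poly Z) = #|Z|.+1.
Proof. by rewrite size_prod_XsubC -cardE. Qed.

Lemma nodes_polyE Z i : (nodes_poly Z).[node i] = \prod_(z in Z) (node i - node z).
Proof.
rewrite /nodes_poly horner_prod big_enum /=.
by apply: eq_bigr => z _; rewrite !hornerE.
Qed.

Lemma nodes_poly_eq0 Z (i : 'I_n) : ((nodes_poly Z).[node i] == 0) = (i \in Z).
Proof.
rewrite nodes_polyE; apply/idP/idP => [|iZ]; last by rewrite (bigD1 i) //= subrr mul0r.
by case/prodf_eq0 => z zZ; rewrite subr_eq0 eqr_nat eqSS => /eqP/val_inj->.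
Qed.

Section Direction.
Variables (Z : {set 'I_n}) (z0 : 'I_n).
Hypothesis z0Z : z0 \in Z.

Definition diffs : #|Z :\ z0|.-tuple 'rV[R]_d :=
  [tuple curve (tnth (enum_tuple (Z :\ z0)%SET) i) - curve z0 | i < #|(Z :\ z0)%SET|].

Lemma mem_diffs z : z \in Z -> curve z - curve z0 \in <<diffs>>%VS.
Proof.
move=> zZ; have [->|zz0] := eqVneq z z0; first by rewrite subrr mem0v.
apply: memv_span; have /tnthP[k Ek] : z \in enum_tuple (Z :\ z0)%SET.
  by rewrite mem_enum !inE zz0.
by apply/mapP; exists k; rewrite ?mem_enum // -Ek.
Qed.

(** Interpolation: the polynomial vanishing at all nodes of [Z] but one has degree at most [d], and
    its form isolates one coefficient of a linear relation. *)
Lemma free_diffs : (#|Z| <= d.+1)%N -> free diffs.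
Proof.
move=> Zd; apply/freeP => k sum0 i0.
set zs := enum_tuple (Z :\ z0)%SET.
have zsZ i : tnth zs i \in (Z :\ z0)%SET.
  by have := mem_tnth i zs; rewrite mem_enum.
pose h := nodes_poly (Z :\ tnth zs i0)%SET.
have sh : (size h <= d.+1)%N.
  apply: leq_trans Zd; rewrite size_nodes_poly (cardsD1 (tnth zs i0) Z).
  by have := zsZ i0; rewrite in_setD1 => /andP[_ ->].
have z0h : h.[node z0] = 0.
  by apply/eqP; rewrite nodes_poly_eq0 in_setD1 z0Z andbT eq_sym; have := zsZ i0; rewrite in_setD1 => /andP[].
have dE (i : 'I_#|(Z :\ z0)%SET|) : dotmul (\row_j h`_j.+1) diffs`_i = h.[node (tnth zs i)].
  have -> : diffs`_i = curve (tnth zs i) - curve z0 by rewrite -tnth_nth tnth_mktuple.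
  have := polyform_curve z0 sh; have <- := polyform_curve (tnth zs i) sh.
  by rewrite dotmulB z0h /polyform; lra.
have : dotmul (\row_j h`_j.+1) (\sum_(i < #|(Z :\ z0)%SET|) k i *: diffs`_i) = 0.
  by rewrite sum0 /dotmul big1 // => j _; rewrite [X in _ * X]mxE mulr0.
rewrite dotmul_sum (eq_bigr (fun i => k i * h.[node (tnth zs i)])); last first.
  by move=> i _; rewrite dE.
rewrite (bigD1 i0) //= big1 => [|i ii0].
  rewrite addr0 => /eqP; rewrite mulf_eq0 => /orP[/eqP//|].
  by rewrite nodes_poly_eq0 !inE eqxx.
suff -> : h.[node (tnth zs i)] = 0 by rewrite mulr0.
apply/eqP; rewrite nodes_poly_eq0 in_setD1.
have := zsZ i; rewrite in_setD1 => /andP[_ ->]; rewrite andbT.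
apply: contraNneq ii0 => E; apply/eqP; have us : uniq zs by apply: enum_uniq.
by apply: val_inj => /=; apply/eqP; rewrite -(nth_uniq z0 _ _ us) ?size_tuple // -!tnth_nth E.
Qed.

Lemma combo_direction (A : set 'rV[R]_d) : (forall z, z \in Z -> A (curve z)) ->
  (forall x, A x -> is_combo Z x) -> is_direction A <<diffs>>%VS.
Proof.
move=> AZ Acombo; split=> [x y Ax Ay|W HW]; last first.
  apply/span_subvP => v /mapP[i _ ->]; apply: HW; apply: AZ => //.
  have : tnth (enum_tuple (Z :\ z0)%SET) i \in (Z :\ z0)%SET.
    by have := mem_tnth i (enum_tuple (Z :\ z0)%SET); rewrite mem_enum.
  by rewrite in_setD1 => /andP[].
have base u : A u -> u - curve z0 \in <<diffs>>%VS.
  move=> /Acombo[w [_ wZ w1 ->]]; have -> : curve z0 = \sum_i w i *: curve z0 by rewrite -scaler_suml w1 scale1r.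
  rewrite -sumrB.
  apply: memv_suml => i _; have [iZ|/wZ->] := boolP (i \in Z).
    by rewrite -scalerBr memvZ // mem_diffs.
  by rewrite !scale0r subr0 mem0v.
have -> : x - y = (x - curve z0) - (y - curve z0) by rewrite opprB addrA subrK.
by rewrite memvB // base.
Qed.

Lemma dim_diffs : (#|Z| <= d.+1)%N -> (\dim <<diffs>>%VS).+1 = #|Z|.
Proof.
move=> Zd; have := free_diffs Zd; rewrite /free size_tuple => /eqP->.
by rewrite (cardsD1 z0 Z) z0Z.
Qed.

End Direction.

Lemma direction_uniq (A : set 'rV[R]_d) (U W : {vspace 'rV[R]_d}) :
  is_direction A U -> is_direction A W -> U = W.
Proof.
move=> [U1 U2] [W1 W2]; apply: subv_anti; apply/andP; split; [exact: U2|exact: W2].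
Qed.

Lemma affine_dim_uniq (A : set 'rV[R]_d) k l : has_affine_dim A k -> has_affine_dim A l -> k = l.
Proof.
by move=> [_ [U dU <-]] [_ [W dW <-]]; rewrite (direction_uniq dU dW).
Qed.

Lemma combo_affine_dim (A : set 'rV[R]_d) Z : (0 < #|Z| <= d.+1)%N ->
  (forall z, z \in Z -> A (curve z)) -> (forall x, A x -> is_combo Z x) ->
  has_affine_dim A #|Z|.-1.
Proof.
move=> /andP[/card_gt0P[z0 z0Z] Zd] AZ Acombo; split; first by exists (curve z0); apply: AZ.
by exists <<diffs Z z0>>%VS; [exact: combo_direction|rewrite -(dim_diffs z0Z Zd)].
Qed.

Lemma polytope_affine_dim : (d < n)%N -> has_affine_dim P d.
Proof.
move=> dn; have n0 : (0 < n)%N by apply: leq_trans dn.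
pose z0 := Ordinal n0; split; first by exists (curve z0); apply: hull_curve.
have z0T : z0 \in [set: 'I_n]%SET by rewrite inE.
have dT := combo_direction z0T (fun z _ => hull_curve z) hull_combo.
exists <<diffs [set: 'I_n]%SET z0>>%VS => //; apply/eqP; rewrite eqn_leq; apply/andP; split.
  by rewrite (leq_trans (dimvS (subvf _))) // dimvf dim_matrix mul1r.
pose Z := [set i : 'I_n | (i <= d)%N]%SET.
have z0Z : z0 \in Z by rewrite inE.
have cZ : #|Z| = d.+1.
  have -> : Z = [set widen_ord dn i | i in 'I_d.+1]%SET.
    apply/setP => i; rewrite inE; apply/idP/imsetP => [id|[j _ ->]]; last by rewrite /= -ltnS.
    by exists (inord i) => //; apply: val_inj; rewrite /= inordK.
  by rewrite card_imset ?card_ord // => i j /(congr1 val) /= /val_inj.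
have Zd : (#|Z| <= d.+1)%N by rewrite cZ.
have := dim_diffs z0Z Zd; rewrite cZ => -[Ed]; rewrite -[leqLHS]Ed; apply: dimvS; apply/span_subvP => v /mapP[i _ ->].
by case: dT => H _; apply: H; apply: hull_curve.
Qed.

(** [nodes_poly S] itself supports the facet: its [d] zeros on the curve are affinely independent
    and span dimension [d - 1]. *)
Lemma FC_nodes_poly (S : {set 'I_n}) : (1 < d < n)%N -> #|S| = d ->
  (forall i : 'I_n, 0 <= (nodes_poly S).[node i]) -> S \in FC R d n.
Proof.
move=> /andP[d1 dn] cS S0; have d0 := ltnW d1.
have sS : (size (nodes_poly S) <= d.+1)%N by rewrite size_nodes_poly cS.
have zS : zeros (nodes_poly S) = S by apply/setP => i; rewrite inE nodes_poly_eq0.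
rewrite inE; apply/asboolP; exists (poly_face (nodes_poly S)); last first.
  by rewrite vertices_poly_face // zS.
split.
  apply/face_polyform; exists (nodes_poly S); split=> // x.
  exact: hull_polyform_ge0.
exists d.-1; first by rewrite prednK //; apply: polytope_affine_dim.
have <- : #|S|.-1 = d.-1 by rewrite cS.
apply: combo_affine_dim.
- by rewrite cS d0 leqnSn.
- by move=> z zz; apply/poly_face_curve; rewrite ?zS.
- by move=> x xF; rewrite -zS; apply: poly_face_combo.
Qed.

(** A supporting polynomial has degree at most [d] and vanishes on [S], which has [d] elements by
    dimension. So it is a multiple of [nodes_poly S], by a factor whose sign is still open. *)
Lemma FC_poly (S : {set 'I_n}) : (1 < d < n)%N -> S \in FC R d n ->
  #|S| = d /\ exists c : R, forall i : 'I_n, 0 <= c * (nodes_poly S).[node i] /\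
    (i \notin S -> 0 < c * (nodes_poly S).[node i]).
Proof.
move=> /andP[d1 dn]; have d0 := ltnW d1.
rewrite inE => /asboolP[F [/face_polyform[g [sg g0 FE]] [k dimP dimF]] vF].
have gn (i : 'I_n) : 0 <= g.[node i] by rewrite -(polyform_curve i sg); apply: g0; apply: hull_curve.
have FE' : F = poly_face g by [].
have SZ : S = zeros g.
  apply/setP => i; have := vertices_poly_face d1 sg gn; rewrite -FE' vF => E.
  apply/idP/idP => iS.
    have : (curve @` [set i | i \in S]) (curve i) by exists i.
    by rewrite E => -[j jS /(curve_inj d0) <-].
  have : (curve @` [set i | i \in zeros g]) (curve i) by exists i.
  by rewrite -E => -[j jS /(curve_inj d0) <-].
have kd : k.+1 = d by apply: affine_dim_uniq dimP (polytope_affine_dim dn).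
have gN0 : g != 0.
  apply/eqP => E; have : F = P.
    rewrite FE E; apply/seteqP; split=> [x []//|x Px]; split=> //=.
    rewrite /polyform coef0 add0r /dotmul big1 // => j _.
    by rewrite mxE coef0 mul0r.
  by move=> EF; rewrite EF in dimF; have := affine_dim_uniq dimP dimF; lia.
have rootsS : all (root g) [seq node i | i : 'I_n <- enum S].
  apply/allP => _ /mapP[i iS ->]; rewrite mem_enum SZ inE in iS.
  by rewrite /root.
have uS : uniq [seq node i | i : 'I_n <- enum S].
  rewrite map_inj_uniq ?enum_uniq // => i j /eqP.
  by rewrite eqr_nat eqSS => /eqP/val_inj.
have Sd : (#|S| <= d)%N.
  have := max_poly_roots gN0 rootsS uS; rewrite size_map -cardE => /leq_trans/(_ sg).
  by rewrite ltnS.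
have S0 : (0 < #|S|)%N.
  have [[x] Fx _] := dimF; rewrite FE' in Fx.
  have [w [i iZ _]] := combo_pos (poly_face_combo sg gn Fx).
  by apply/card_gt0P; exists i; rewrite SZ.
have cS : #|S| = d.
  have := @combo_affine_dim F S; rewrite S0 (leq_trans Sd) // => /(_ isT) H.
  have : has_affine_dim F #|S|.-1.
    apply: H => [z|x]; rewrite SZ FE'; first by move/poly_face_curve; apply.
    exact: poly_face_combo.
  by move/(affine_dim_uniq dimF); lia.
split=> //; exists (lead_coef g) => i.
have gE : g = lead_coef g *: nodes_poly S.
  rewrite {1}(all_roots_prod_XsubC _ rootsS); last by rewrite uniq_rootsE.
    by rewrite big_map.
  have := max_poly_roots gN0 rootsS uS; rewrite size_map -cardE cS => H.
  by apply/eqP; rewrite eqn_leq sg.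
have Ei : lead_coef g * (nodes_poly S).[node i] = g.[node i] by rewrite {2}gE hornerZ.
rewrite Ei; split=> // iS; rewrite lt0r gn andbT.
by move: iS; rewrite SZ inE.
Qed.

End CyclicPolytope.

(** * The conflict-free chromatic number *)

Section Gale.
Variables (R : realType) (n m : nat).
Hypothesis m0 : (0 < m)%N.
Hypothesis mn : (2 * m < n)%N.
Local Notation FCm := (FC R (2 * m) n).
Local Notation node i := (i.+1%:R : R).

Let deg_range : (1 < 2 * m < n)%N.
Proof. by rewrite mn andbT mul2n -addnn; case: m m0 => // k _; rewrite addSn addnS. Qed.

Lemma pair_left_lt (i : 'I_n./2) : (i.*2 < n)%N.
Proof. by have := ltn_ord i; rewrite -{2}(odd_double_half n); lia. Qed.

Lemma pair_right_lt (i : 'I_n./2) : (i.*2.+1 < n)%N.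
Proof. by have := ltn_ord i; rewrite -{2}(odd_double_half n); lia. Qed.

Definition pair_left (i : 'I_n./2) : 'I_n := Ordinal (pair_left_lt i).
Definition pair_right (i : 'I_n./2) : 'I_n := Ordinal (pair_right_lt i).

Lemma pair_left_inj : injective pair_left.
Proof. by move=> i j /(congr1 val) /= E; apply: val_inj; apply: double_inj. Qed.

Lemma pair_right_inj : injective pair_right.
Proof. by move=> i j /(congr1 val) /= [E]; apply: val_inj; apply: double_inj. Qed.

Lemma pair_left_right i j : pair_left i != pair_right j.
Proof.
by apply/eqP => /(congr1 (fun x => odd (val x))); rewrite /= !odd_double.
Qed.

(** Each pair contributes two factors with consecutive integer roots, whose product is nonnegative
    at every integer. *)
Lemma FC_pairs (I : {set 'I_n./2}) : #|I| = m -> (pair_left @: I :|: pair_right @: I)%SET \in FCm.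
Proof.
move=> cI; have dis : fintype.disjoint (mem (pair_left @: I)%SET) (mem (pair_right @: I)%SET).
  rewrite -finset.setI_eq0; apply/eqP/setP => x; rewrite finset.in_setI finset.in_set0.
  by apply/negP => /andP[/imsetP[i _ ->] /imsetP[j _ E]]; have := pair_left_right i j; rewrite E eqxx.
apply: FC_nodes_poly => //.
  by rewrite cardsU finset.disjoint_setI0 // cards0 subn0 !card_imset ?cI ?addnn ?mul2n //;
    [exact: pair_right_inj|exact: pair_left_inj].
move=> x; rewrite nodes_polyE (eq_bigl [predU (pair_left @: I)%SET & (pair_right @: I)%SET]); last first.
  by move=> z; rewrite finset.in_setU.
rewrite bigU //= (big_imset _ (in2W pair_left_inj)) (big_imset _ (in2W pair_right_inj)) /=.
rewrite -big_split; apply: prodr_ge0 => i _ /=.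
have [le|lt] := leqP x i.*2.
  by rewrite mulr_le0 // subr_le0 ler_nat ltnS // ltnW.
by rewrite mulr_ge0 // subr_ge0 ler_nat // ltnS ltnW.
Qed.

Lemma nodes_poly_sign (S : {set 'I_n}) (j : 'I_n) : j \notin S ->
  0 < (-1) ^+ #|[set z in S | (j < z)%N]%SET| * (nodes_poly R S).[node j].
Proof.
move=> jS; rewrite nodes_polyE.
have -> : #|[set z in S | (j < z)%N]%SET| = (\sum_(z in S) (j < z)%N)%N.
  rewrite -sum1_card big_mkcond [RHS]big_mkcond; apply: eq_bigr => z _.
  by rewrite inE; case: (z \in S); case: (j < z)%N.
rewrite expr_sum -big_split; apply: prodr_gt0 => z zS /=.
have [lt|gt|E] := ltngtP j z.
- by rewrite expr1 mulN1r oppr_gt0 subr_lt0 ltr_nat ltnS.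
- by rewrite expr0 mul1r subr_gt0 ltr_nat ltnS.
- by rewrite (val_inj E) zS in jS.
Qed.

(** At the first point, outside [S], all [2 * m] factors are negative, so the constant [c] is
    positive. Then each [j] outside [S] has evenly many nodes above it, hence also below it. *)
Lemma FC_gale (S : {set 'I_n}) : S \in FCm -> #|S| = (2 * m)%N /\
  ((forall i : 'I_n, i \in S -> (0 < i)%N) ->
   forall j, j \notin S -> ~~ odd #|[set i in S | (i < j)%N]%SET|).
Proof.
move=> /(FC_poly deg_range)[cS [c cP]]; split=> // S0 j jS.
have n0 : (0 < n)%N by apply: leq_ltn_trans mn.
pose z := Ordinal n0; have zS : z \notin S by apply/negP => /S0.
have even_above i : i \notin S -> 0 < c -> ~~ odd #|[set z in S | (i < z)%N]%SET|.
  move=> iS c0; have := nodes_poly_sign iS; have [_ /(_ iS)] := cP i; rewrite pmulr_rgt0 //.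
  rewrite -signr_odd; case: (odd _) => //= g0.
  by rewrite expr1 mulN1r oppr_gt0 => /(lt_trans g0); rewrite ltxx.
have c0 : 0 < c.
  have [_ /(_ zS)] := cP z; have := nodes_poly_sign zS.
  have -> : [set i in S | (z < i)%N]%SET = S.
    by apply/setP => i; rewrite inE; apply: andb_idr => /S0.
  by rewrite cS exprM sqrrN expr1n expr1n mul1r => /pmulr_lgt0->.
have := even_above j jS c0; have := cardsID [set i : 'I_n | (i < j)%N]%SET S; rewrite cS.
have -> : (S :&: [set i : 'I_n | (i < j)%N])%SET = [set i in S | (i < j)%N]%SET.
  by apply/setP => i; rewrite !inE.
have -> : (S :\: [set i : 'I_n | (i < j)%N])%SET = [set i in S | (j < i)%N]%SET.
  apply/setP => i; rewrite !inE -leqNgt leq_eqVlt andbC.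
  by case: eqVneq => [E|//]; rewrite -(val_inj E) (negbTE jS).
move/(congr1 odd); rewrite oddD mul2n odd_double => E evR.
by move: E; rewrite (negbTE evR) addbF => ->.
Qed.

Lemma chi_colorable (H : {set {set 'I_n}}) : cf_colorable H (chi_CF H).
Proof. by rewrite /chi_CF; case: ex_minnP. Qed.

Lemma chi_le (H : {set {set 'I_n}}) k : cf_colorable H k -> (chi_CF H <= k)%N.
Proof. by rewrite /chi_CF; case: ex_minnP => c _; apply. Qed.

Lemma chi_lower (r : nat) : exponent_pair r m ->
  (n ^ r <= (3 ^ r * (2 * (240 * m) ^ r)) * chi_CF FCm ^ r.+1)%N.
Proof.
move=> rm; have n2 : (1 < n)%N by apply: leq_ltn_trans mn; rewrite mul2n; case: (m) m0.
(* The source of the factor [3 ^ r]; equality holds at [n = 3]. *)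
have n3 : (n <= 3 * n./2)%N.
  by rewrite -{1}(odd_double_half n); move: n2; rewrite -{1}(odd_double_half n); lia.
apply: (@leq_trans ((3 * n./2) ^ r)%N).
  by case: (r) => [|r'] //; rewrite leq_exp2r.
rewrite expnMn -mulnA leq_mul2l; apply/orP; right.
have /existsP[phi cf] := chi_colorable FCm; rewrite leqNgt; apply/negP => big.
have k0 : (0 < chi_CF FCm)%N.
  by apply: leq_ltn_trans (ltn_ord (phi (Ordinal (ltnW n2)))).
have [I rep cI] := @repeating_pairs r m n./2 (chi_CF FCm) (fun i => phi (pair_left i))
  (fun i => phi (pair_right i)) rm k0 big.
have /forall_inP/(_ _ (FC_pairs cI)) := cf; set S := (_ :|: _)%SET.
have S0 : S != finset.set0.
  have /card_gt0P[i iI] : (0 < #|I|)%N by rewrite cI.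
  by apply/finset.set0Pn; exists (pair_left i); rewrite finset.in_setU imset_f.
rewrite S0 => /exists_inP[x xS /forall_inP uniq_x].
have contra_x y : y \in S -> y != x -> phi y = phi x -> False.
  by move=> yS yx E; have := uniq_x y; rewrite in_setD1 yx yS E eqxx => /(_ isT).
move: xS; rewrite finset.in_setU => /orP[]/imsetP[i iI Ex].
  have [[i' [i'I ne E]] _] := rep i iI.
  apply: (contra_x (pair_left i')); rewrite ?Ex //; first by rewrite finset.in_setU imset_f.
  by rewrite (inj_eq pair_left_inj).
have [_ [i' [i'I ne E]]] := rep i iI.
apply: (contra_x (pair_right i')); rewrite ?Ex //; first by rewrite finset.in_setU [X in _ || X]imset_f ?orbT.
by rewrite (inj_eq pair_right_inj).
Qed.

Lemma chi_upper (s : nat) : wenger_free s m ->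
  (chi_CF FCm ^ s.+2 <= wenger_const s * n ^ s.+1)%N.
Proof.
move=> sm; have n0 : (0 < n)%N by apply: leq_ltn_trans mn.
have [V [e [c [esym eirr free cP cV]]]] := sparse_trail_coloring sm n0.
apply: leq_trans cV; rewrite leq_exp2r //; apply: chi_le.
have -> : (2 * #|V| = #|{: V + V}|)%N by rewrite card_sum addnn mul2n.
apply/existsP; exists [ffun i : 'I_n => enum_rank (c i)].
apply/forall_inP => S /FC_gale[cS gale]; apply/implyP => _.
have [x xS ux] := trail_coloring_conflict_free esym eirr free cP m0 cS gale.
apply/exists_inP; exists x => //; apply/forall_inP => y; rewrite in_setD1 => /andP[yx yS].
by rewrite !ffunE (inj_eq enum_rank_inj) ux.
Qed.

End Gale.

(** Both bounds are kept as inequalities of natural numbers up to here; taking roots of order [r.+1]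
    introduces the real exponent. *)
Lemma Theta_powR (R : realType) (f : nat -> nat) (r A B N : nat) : (0 < A)%N -> (0 < B)%N ->
  (forall n, (N < n)%N -> (n ^ r <= A * f n ^ r.+1)%N /\ (f n ^ r.+1 <= B * n ^ r)%N) ->
  (fun n => (f n)%:R : R^o) =Theta_\oo (fun n => (n%:R : R) `^ (r%:R / r.+1%:R) : R^o).
Proof.
move=> A0 B0 H; rewrite eqThetaE qualifE; apply/asboolP.
pose e : R := r.+1%:R^-1; have e0 : 0 <= e by rewrite invr_ge0.
have pow_root (k : nat) : (k%:R ^+ r.+1) `^ e = k%:R :> R.
  by rewrite -powR_mulrn // -powRrM mulfV ?powRr1.
have pow_nat (k : nat) : (k%:R ^+ r) `^ e = k%:R `^ (r%:R / r.+1%:R) :> R.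
  by rewrite -powR_mulrn // -powRrM.
have mono (x y : nat) : (x <= y)%N -> (x%:R `^ e <= y%:R `^ e :> R).
  by move=> xy; apply: ge0_ler_powR; rewrite ?nnegrE ?ler_nat.
have pA : 0 < A%:R `^ e :> R by apply: powR_gt0; rewrite ltr0n.
have pB : 0 < B%:R `^ e :> R by apply: powR_gt0; rewrite ltr0n.
exists ((A%:R `^ e)^-1, B%:R `^ e) => /=; first by rewrite invr_gt0 pA pB.
exists N.+1 => // n /= Nn; have [H1 H2] := H n Nn.
rewrite !ger0_norm ?powR_ge0 //; split.
  rewrite ler_pdivrMl //.
  by have := mono _ _ H1; rewrite natrM !natrX powRM ?exprn_ge0 // pow_root pow_nat.
by have := mono _ _ H2; rewrite natrM !natrX powRM ?exprn_ge0 // pow_root pow_nat.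
Qed.

Lemma chi_FC_Theta (R : realType) (s m : nat) : wenger_free s m -> exponent_pair s.+1 m ->
  (fun n => (chi_CF (FC R (2 * m) n))%:R : R^o) =Theta_\oo
    (fun n => (n%:R : R) `^ (s.+1%:R / s.+2%:R) : R^o).
Proof.
move=> sm rm; have m0 : (0 < m)%N.
  by move: sm; rewrite /wenger_free; case: (m) => //; case: (s) => [|[|[|[|[]]]]].
apply: (@Theta_powR _ _ s.+1 (3 ^ s.+1 * (2 * (240 * m) ^ s.+1)) (wenger_const s) (2 * m)).
- by rewrite !muln_gt0 !expn_gt0 muln_gt0 m0.
- by rewrite muln_gt0 !expn_gt0.
by move=> n mn; split; [exact: chi_lower|exact: chi_upper].
Qed.

Theorem theorem1p4 (R : realType) :
  (fun n : nat => (chi_CF (FC R 4 n))%:R : R^o) =Theta_\oo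
    (fun n : nat => Num.sqrt (n%:R : R) : R^o) /\
  (fun n : nat => (chi_CF (FC R 6 n))%:R : R^o) =Theta_\oo
    (fun n : nat => Num.sqrt (n%:R : R) : R^o) /\
  (fun n : nat => (chi_CF (FC R 8 n))%:R : R^o) =Theta_\oo
    (fun n : nat => (n%:R : R) `^ (2 / 3) : R^o) /\
  (fun n : nat => (chi_CF (FC R 10 n))%:R : R^o) =Theta_\oo
    (fun n : nat => Num.sqrt (n%:R : R) : R^o) /\
  (fun n : nat => (chi_CF (FC R 12 n))%:R : R^o) =Theta_\oo
    (fun n : nat => (n%:R : R) `^ (3 / 4) : R^o) /\
  (fun n : nat => (chi_CF (FC R 14 n))%:R : R^o) =Theta_\oo
    (fun n : nat => (n%:R : R) `^ (2 / 3) : R^o) /\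
  (fun n : nat => (chi_CF (FC R 18 n))%:R : R^o) =Theta_\oo
    (fun n : nat => (n%:R : R) `^ (3 / 4) : R^o) /\
  (fun n : nat => (chi_CF (FC R 20 n))%:R : R^o) =Theta_\oo
    (fun n : nat => (n%:R : R) `^ (5 / 6) : R^o).
Proof.
have -> : (fun n : nat => Num.sqrt (n%:R : R) : R^o) = (fun n : nat => (n%:R : R) `^ (1 / 2) : R^o).
  by apply/funext => n; rewrite div1r powR12_sqrt.
do !split.
- by apply: (@chi_FC_Theta R 0 2) => //; right.
- by apply: (@chi_FC_Theta R 0 3) => //; right.
- by apply: (@chi_FC_Theta R 1 4) => //; left.
- by apply: (@chi_FC_Theta R 0 5) => //; right.
- by apply: (@chi_FC_Theta R 2 6) => //; left.
- by apply: (@chi_FC_Theta R 1 7) => //; left.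
- by apply: (@chi_FC_Theta R 2 9) => //; left.
- by apply: (@chi_FC_Theta R 4 10) => //; left.
Qed.
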